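(* Suppose $\pi:X\to T$ is a tree of metric spaces satisfying the properties $(\mathcal P0)$--$(\mathcal P4)$ listed in the context. Then $X$ is a hyperbolic geodesic metric space.
   Context: A function $\phi:\mathbb R_{\ge0}\to\mathbb R_{\ge0}$ is proper if $\phi(r)\to\infty$ as $r\to\infty$; a map $f$ is a $\phi$-proper embedding if $d(f(x),f(x'))\le r$ implies $d(x,x')\le\phi(r)$. A geodesic metric space is $\delta$-hyperbolic if all its geodesic triangles are $\delta$-slim. For $A\subseteq X$, a $C$-coarsely Lipschitz retraction of $X$ on $A$ is a map $g:X\to A$ with $d(g(x),g(x'))\le C\,d(x,x')+C$ for all $x,x'$ and $g(a)=a$ for $a\in A$. $N_r(A)=\{x:d(x,A)\le r\}$. Rectifiably connected subsets carry the induced path metric. Tree of metric spaces. $T$ is a simplicial tree, $X$ a geodesic metric space, and $\pi:X\to T$ a $1$-Lipschitz surjection for which there is a proper map $\phi$ such that: (i) for each vertex $v$, $X_v=\pi^{-1}(v)$ is a geodesic metric space with the path metric induced from $X$, and $X_v\to X$ is a $\phi$-proper embedding; (ii) for each edge $e=[v,w]$ with midpoint $m_e$, $X_e=\pi^{-1}(m_e)$ is geodesic with the induced path metric, and there is a map $\vartheta_e:X_e\times[0,1]\to\pi^{-1}(e)$ such that $\pi\circ\vartheta_e$ is the projection onto $[v,w]$, $\vartheta_e|_{X_e\times(0,1)}$ is an isometry onto $\pi^{-1}(\mathrm{int}(e))$, and the restrictions of $\vartheta_e$ to $X_e\times\{0\}$ and $X_e\times\{1\}$ are $\phi$-proper embeddings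 into $X_v$ and $X_w$ with their path metrics. For a subtree $S\subseteq T$ put $X_S=\pi^{-1}(S)$; $u,v,w\in T$ always denote vertices. For each vertex $u$ of $T$ there is a subspace $\mathcal M(X_u)\subseteq X$ containing $X_u$, and there are constants $L'\ge0$, $C\ge0$, $L\ge0$, $\delta\ge0$ and a proper map $\eta:\mathbb R_{\ge0}\to\mathbb R_{\ge0}$ (independent of the vertices) such that: $(\mathcal P0)$ If $u,v\in T$, $e$ is the edge on the geodesic $[u,v]$ incident on $v$, and $T'$ is the maximal subtree of $T$ containing $v$ but not containing $e$, then $\mathcal M(X_u)\cap X_{T'}\subseteq\mathcal M(X_v)\cap X_{T'}$. $(\mathcal P1)$ For each $u\in T$ there is an $L'$-coarsely Lipschitz retraction $\rho_u:X\to\mathcal M(X_u)$ such that, with $T_u=\pi(\mathcal M(X_u))$: whenever $e$ is an edge of $T$ intersecting $T_u$ at a vertex, $v$ is the vertex of $e$ not in $T_u$, and $S$ is the maximal subtree of $T$ containing $v$ but not containing $e$, then $\mathrm{diam}(\rho_u(X_S))\le C$. $(\mathcal P2)$ For each $u$, $N_L(\mathcal M(X_u))$ is path connected, and with the path metric induced from $X$ the inclusion $N_L(\mathcal M(X_u))\to X$ is an $\eta$-proper embedding. Call $[u,v]\subseteq T$ a special interval if $\mathcal M(X_u)\cap X_v\ne\emptyset$ or $X_u\cap\mathcal M(X_v)\ne\emptyset$. If $[u,v]$ is a special interval then: $(\mathcal P3)$ the inclusion $N_L(\mathcal M(X_u))\cup N_L(\mathcal M(X_v))\to X$ is an $\eta$-proper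 embedding (with respect to the induced path metric on the source), and $(\mathcal P4)$ $N_L(\mathcal M(X_u))\cup N_L(\mathcal M(X_v))$ with the induced path metric is a $\delta$-hyperbolic metric space.
   Formalization: The map ϑ_e : X_e×[0,1] → π^{-1}(e) is required to be continuous; for an arbitrary, possibly discontinuous function at the ends the claim is false, since an open flat strip can be attached at single points. *)

(* Defs.v *)
From mathcomp Require Import all_boot all_order all_algebra.
From mathcomp Require Import all_classical all_reals all_analysis.
Set Implicit Arguments.
Unset Strict Implicit.
Unset Printing Implicit Defensive.
Import Order.TTheory GRing.Theory Num.Theory.
Import numFieldTopology.Exports.
Local Open Scope classical_set_scope.
Local Open Scope ring_scope.

(* A subset A of U together with a distance d that is only meaningful on A
   stands for the metric space (A, d).  This lets a subset of X carry either the
   restricted metric or its own path metric. *)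
Section metric_notions.
Context {R : realType}.

Definition is_geodesic {U : Type} (A : set U) (d : U -> U -> R)
    (x y : U) (g : R -> U) : Prop :=
  [/\ g 0 = x, g (d x y) = y,
      forall s, 0 <= s <= d x y -> A (g s)
    & forall s t, 0 <= s <= d x y -> 0 <= t <= d x y ->
        d (g s) (g t) = `|s - t|].

Definition geodesic_space {U : Type} (A : set U) (d : U -> U -> R) : Prop :=
  forall x y, A x -> A y -> exists g, is_geodesic A d x y g.

Definition side {U : Type} (d : U -> U -> R) (x y : U) (g : R -> U) : set U :=
  [set g s | s in [set s | 0 <= s <= d x y]].

(* Triangles are listed with their sides in cyclic order, so that the condition
   on the first side of every triangle is the condition on all three sides. *)
Definition slim_triangles {U : Type} (delta : R) (A : set U)
    (d : U -> U -> R) : Prop :=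
  forall (x y z : U) (f g h : R -> U), A x -> A y -> A z ->
    is_geodesic A d x y f -> is_geodesic A d y z g -> is_geodesic A d z x h ->
    forall p, side d x y f p ->
      exists2 q, (side d y z g `|` side d z x h) q & d p q <= delta.

Definition hyperbolic {U : Type} (delta : R) (A : set U)
    (d : U -> U -> R) : Prop :=
  geodesic_space A d /\ slim_triangles delta A d.

(* Functions on the nonnegative reals are represented by functions on R whose
   values at negative arguments are irrelevant. *)
Definition proper_map (phi : R -> R) : Prop :=
  (forall r, 0 <= r -> 0 <= phi r) /\ (phi r @[r --> +oo] --> +oo).

Definition proper_embedding {U W : Type} (phi : R -> R) (A : set U)
    (dA : U -> U -> R) (dB : W -> W -> R) (f : U -> W) : Prop :=
  forall x x' r, A x -> A x' -> 0 <= r ->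
    dB (f x) (f x') <= r -> dA x x' <= phi r.

Section subsets.
Context {X : metricType R}.

Definition curve_in (A : set X) (x y : X) (g : R -> X) : Prop :=
  [/\ {within `[0, 1], continuous g}, g 0 = x, g 1 = y
    & forall s, 0 <= s <= 1 -> A (g s)].

Definition curve_length (g : R -> X) : \bar R :=
  ereal_sup [set (\sum_(0 <= n < size s)
                    mdist (g (nth 1 (0 :: s) n)) (g (nth 1 (0 :: s) n.+1)))%:E
            | s in itv_partition 0 1].

Definition path_connected (A : set X) : Prop :=
  forall x y, A x -> A y -> exists g, curve_in A x y g.

Definition rectifiably_connected (A : set X) : Prop :=
  forall x y, A x -> A y ->
    exists2 g, curve_in A x y g & (curve_length g < +oo)%E.

(* A metric on A as soon as A is rectifiably connected (on pairs of points not
   joined by a rectifiable curve, [fine] would return the junk value 0). *)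
Definition path_dist (A : set X) (x y : X) : R :=
  fine (ereal_inf [set curve_length g | g in curve_in A x y]).

Definition path_geodesic (A : set X) : Prop :=
  rectifiably_connected A /\ geodesic_space A (path_dist A).

Definition nbhd (r : R) (A : set X) : set X :=
  [set x | (ereal_inf [set (mdist x a)%:E | a in A] <= r%:E)%E].

Definition diam_le (A : set X) (C : R) : Prop :=
  forall x y, A x -> A y -> mdist x y <= C.

Definition coarse_retraction (C : R) (A : set X) (g : X -> X) : Prop :=
  [/\ forall x, A (g x),
      forall x x', mdist (g x) (g x') <= C * mdist x x' + C
    & forall a, A a -> g a = a].

End subsets.
End metric_notions.

Section trees.
Context {R : realType} {T : metricType R}.
Implicit Types (V S : set T) (u v w : T).

(* In a tree this is the geodesic [u, v]. *)
Definition segment u v : set T :=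
  [set t | mdist u t + mdist t v = mdist u v].

(* Edges have length 1; the edge with endpoints v, w is [segment v w]. *)
Definition adjacent V v w : Prop := [/\ V v, V w & mdist v w = 1].

Definition edge_interior v w : set T := segment v w `\` [set v; w].

Definition simple_edge_path V v w (p : seq T) : Prop :=
  [/\ path (fun a b => `[< adjacent V a b >]) v p, last v p = w & uniq (v :: p)].

(* T is the geometric realization, with unit edges and the path metric, of a
   combinatorial tree with vertex set V.  The openness of open edges says that
   an edge is attached to the rest of T at its endpoints only. *)
Record simplicial_tree V : Prop := SimplicialTree {
  st_geodesic : geodesic_space [set: T] mdist;
  st_nonempty : V !=set0;
  st_separated : forall v w, V v -> V w -> v <> w -> 1 <= mdist v w;
  st_cover : forall t, V t \/ exists v w, adjacent V v w /\ segment v w t;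
  st_edge : forall v w, adjacent V v w ->
    exists2 c, is_geodesic [set: T] mdist v w c
             & segment v w = side mdist v w c;
  st_open : forall v w, adjacent V v w -> open (edge_interior v w);
  st_disjoint : forall v w v' w' t, adjacent V v w -> adjacent V v' w' ->
    edge_interior v w t -> edge_interior v' w' t ->
    (v = v' /\ w = w') \/ (v = w' /\ w = v');
  st_tree : forall v w, V v -> V w -> exists! p, simple_edge_path V v w p
}.

Definition subtree V S : Prop :=
  [/\ S !=set0, connected S
    & forall t, S t -> V t \/
        exists v w, [/\ adjacent V v w, segment v w t & segment v w `<=` S]].

Definition max_subtree_avoiding V v w S : Prop :=
  let P S' := [/\ subtree V S', S' v & ~ (segment w v `<=` S')] in
  P S /\ forall S', P S' -> S `<=` S' -> S' = S.

End trees.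

Section trees_of_spaces.
Context {R : realType} {X T : metricType R}.
Variables (V : set T) (pi : X -> T).
Implicit Types (v w : T) (S : set T).

Definition over S : set X := pi @^-1` S.
Definition vertex_space v : set X := over [set v].

Definition edge_space v w : set X :=
  over [set t | segment v w t /\ mdist v t = 1 / 2].

(* The l^2 product of the path metric of A with the metric of R. *)
Definition cylinder_dist (A : set X) (x : X) (s : R) (x' : X) (s' : R) : R :=
  Num.sqrt (path_dist A x x' ^+ 2 + (s - s') ^+ 2).

(* theta is only meaningful on edge_space v w and [0, 1]; the point of the edge
   with parameter s is its point at distance s from v. *)
Record edge_cylinder (phi : R -> R) v w (theta : X -> R -> X) : Prop :=
  EdgeCylinder {
  ec_continuous : forall x s, edge_space v w x -> 0 <= s <= 1 ->
    forall eps, 0 < eps -> exists2 del, 0 < del &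
      forall x' s', edge_space v w x' -> 0 <= s' <= 1 ->
        cylinder_dist (edge_space v w) x s x' s' < del ->
        mdist (theta x s) (theta x' s') < eps;
  ec_proj : forall x s, edge_space v w x -> 0 <= s <= 1 ->
    segment v w (pi (theta x s)) /\ mdist v (pi (theta x s)) = s;
  ec_rectifiable : rectifiably_connected (over (edge_interior v w));
  ec_isometry : forall x s x' s', edge_space v w x -> edge_space v w x' ->
    0 < s < 1 -> 0 < s' < 1 ->
    path_dist (over (edge_interior v w)) (theta x s) (theta x' s') =
    cylinder_dist (edge_space v w) x s x' s';
  ec_onto : forall y, over (edge_interior v w) y ->
    exists x s, [/\ edge_space v w x, 0 < s < 1 & theta x s = y];
  ec_proper0 : proper_embedding phi (edge_space v w)
    (path_dist (edge_space v w)) (path_dist (vertex_space v)) (theta^~ 0);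
  ec_proper1 : proper_embedding phi (edge_space v w)
    (path_dist (edge_space v w)) (path_dist (vertex_space w)) (theta^~ 1)
}.

Record tree_of_spaces : Prop := TreeOfSpaces {
  ts_tree : simplicial_tree V;
  ts_geodesic : geodesic_space [set: X] mdist;
  ts_lipschitz : forall x y, mdist (pi x) (pi y) <= mdist x y;
  ts_surjective : forall t, exists x, pi x = t;
  ts_fibers : exists2 phi : R -> R, proper_map phi &
    (forall v, V v -> path_geodesic (vertex_space v) /\
      proper_embedding phi (vertex_space v)
        (path_dist (vertex_space v)) mdist id) /\
    (forall v w, adjacent V v w -> path_geodesic (edge_space v w) /\
      exists theta, edge_cylinder phi v w theta)
}.

(* [M u] is the subspace written M(X_u). *)
Variable M : T -> set X.

Definition prop_P0 : Prop :=
  forall u v w T', V u -> V v -> u <> v ->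
    adjacent V w v -> segment w v `<=` segment u v ->
    max_subtree_avoiding V v w T' ->
    M u `&` over T' `<=` M v `&` over T'.

Definition prop_P1 (L' C : R) : Prop :=
  forall u, V u -> exists2 rho, coarse_retraction L' (M u) rho &
    forall t v S, adjacent V t v -> (pi @` M u) t -> ~ (pi @` M u) v ->
      max_subtree_avoiding V v t S -> diam_le (rho @` over S) C.

Definition prop_P2 (L : R) (eta : R -> R) : Prop :=
  forall u, V u ->
    let A := nbhd L (M u) in
    [/\ path_connected A, rectifiably_connected A
      & proper_embedding eta A (path_dist A) mdist id].

(* Degenerate intervals (u = v) are allowed, and are special. *)
Definition special_interval u v : Prop :=
  [/\ V u, V v & (M u `&` vertex_space v !=set0) \/
                 (vertex_space u `&` M v !=set0)].

Definition prop_P3 (L : R) (eta : R -> R) : Prop :=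
  forall u v, special_interval u v ->
    let A := nbhd L (M u) `|` nbhd L (M v) in
    rectifiably_connected A /\ proper_embedding eta A (path_dist A) mdist id.

Definition prop_P4 (L delta : R) : Prop :=
  forall u v, special_interval u v ->
    let A := nbhd L (M u) `|` nbhd L (M v) in
    rectifiably_connected A /\ hyperbolic delta A (path_dist A).

End trees_of_spaces.

(* Main.v *)
Require Import Defs.
From mathcomp Require Import all_boot all_order all_algebra.
From mathcomp Require Import all_classical all_reals all_analysis.
From mathcomp Require Import lra zify.
Import Defs.
Set Implicit Arguments.
Unset Strict Implicit.
Unset Printing Implicit Defensive.
Import Order.TTheory GRing.Theory Num.Theory.
Import numFieldNormedType.Exports.
Local Open Scope classical_set_scope.
Local Open Scope ring_scope.

(** Geodesics of X are found by guessing them. Suppose that every pair of points x, y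
    carries a coarsely connected set L x y which is small when x and y are close and
    lies near the union of L x z and L z y for all z. Bisecting shows that L x y lies
    within a multiple of log n of every path of n steps from x to y, so a point of
    L x y far from a quasi-geodesic yields a point twice as far from a shorter one;
    hence quasi-geodesics and guesses follow each other, and geodesic triangles are as
    slim as the guesses ([coarse_paths_stability]).

    Let N w be the L-neighbourhood of M w. For x over the vertex u and y over the
    vertex v, the guess is the union, over the vertices w of [u, v], of the geodesics
    of N w between the projections of x and y to N w. As N w is hyperbolic and [u, v]
    is covered by [u, s] and [s, v], slimness is clear for the vertices common to the
    three sides of a tripod. If w lies on the leg of u only, with branch vertex b, then
    the projections to N w of the two other points factor through N b, and a geodesic
    of N w between them is short or follows the geodesic between the projections to
    N b ([Proj_dichotomy]). The geodesics for adjacent vertices w are close to each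
    other ([Proj_consecutive]), and points close to the fibre over w hardly move when
    projected to N w ([Proj_near]); so the guesses are connected and local.

    The core is the construction of the projections. Call w and t linked if M w meets
    all vertex spaces over [w, t], or M t does. Then the union of N w and N t is
    hyperbolic, N w is quasiconvex in it because it is a coarse retract
    ([seg_pieces_close]), and N t has a nearest point projection to N w ([gate]).
    Since the part of M w beyond a vertex b lies in M b, a point near N w and N t is
    near N b for every b between w and t ([near_between]); it follows that projecting
    from N t to N w agrees up to a bounded error with projecting to N b first
    ([proj_trans]). For vertices that are not linked, projections are composed along
    the chain that starts at w and always jumps to the furthest linked vertex.

    Such a composite could accumulate errors, but it is bounded after four jumps. By
    then some vertex v separates w from the end t of the chain and is linked to neither
    of them; rho w maps everything beyond v to a bounded set, and so does rho t for the
    other side, so that N w and N t come close to each other in at most two bounded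
    places ([far_bounded]). A composite of projections maps geodesics of N t to short
    geodesics or to geodesics near N t, hence has bounded image ([far_contracting]).
    Thus only boundedly many steps ever have to be compared ([Proj_through]).

    The tree enters through its 0-hyperbolicity ([tree_segment_slim]), which comes
    from a continuous retraction onto each edge that is constant on both sides of it. *)

(** * Families of coarse paths *)

Section stability.
Context {R : realType} {X : metricType R}.
Implicit Types (N S : set X) (L : X -> X -> set X) (x y z p q : X).

Definition near_set (r : R) S : set X := [set p | exists2 q, S q & mdist p q <= r].

Lemma near_setW r r' S S' p : r <= r' -> S `<=` S' -> near_set r S p ->
  near_set r' S' p.
Proof. by move=> rr SS [q Sq pq]; exists q; [exact: SS|exact: le_trans pq rr]. Qed.

Lemma near_set_le r r' S p : r <= r' -> near_set r S p -> near_set r' S p.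
Proof. by move=> rr; apply: near_setW. Qed.

Lemma near_set_trans r r' S S' p :
  near_set r S p -> (forall q, S q -> near_set r' S' q) -> near_set (r + r') S' p.
Proof.
move=> [q Sq pq] /(_ q Sq)[q' S'q' qq']; exists q' => //.
by have := metric_triangle p q q'; lra.
Qed.

Lemma near_set_dist r r' S p q : mdist p q <= r -> near_set r' S q ->
  near_set (r + r') S p.
Proof. by move=> pq qS; apply: (@near_set_trans _ _ [set q]); [exists q|move=> _ ->]. Qed.

Lemma near_set0 r S p : 0 <= r -> S p -> near_set r S p.
Proof. by move=> r0 Sp; exists p => //; rewrite mdistxx. Qed.

Lemma near_setU r S S' p : near_set r (S `|` S') p -> near_set r S p \/ near_set r S' p.
Proof. by move=> [q [Sq|Sq] pq]; [left|right]; exists q. Qed.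

(** The sets L x y, for x and y in N, are guesses for geodesics; they need not lie
    in N, since N will often be a quasiconvex part of a larger piece. *)
Record coarse_paths (sigma D : R) N L : Prop := CoarsePaths {
  cp_connected : forall x y, N x -> N y ->
    exists n (c : nat -> X), [/\ c 0%N = x, c n = y,
      forall i, (i <= n)%N -> near_set D (L x y) (c i)
    & forall i, (i < n)%N -> mdist (c i) (c i.+1) <= D];
  cp_small : forall x y p, N x -> N y -> mdist x y <= sigma -> L x y p ->
    mdist p x <= D;
  cp_slim : forall x y z, N x -> N y -> N z ->
    L x y `<=` near_set D (L x z `|` L z y) }.

Record quasi_path (sigma K : R) N (n : nat) (a : nat -> X) : Prop := QuasiPath {
  qp_in : forall i, (i <= n)%N -> N (a i);
  qp_step : forall i, (i < n)%N -> mdist (a i) (a i.+1) <= sigma;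
  qp_quasi : forall i j, (i <= j <= n)%N ->
    j%:R - i%:R <= K * mdist (a i) (a j) + K }.

(** Cut the path in the middle: each of the k bisections costs one use of slimness,
    and a path of at most one step is handled by smallness. *)
Lemma bisection_log sigma D N L : coarse_paths sigma D N L -> 0 <= sigma -> 0 <= D ->
  forall k n (a : nat -> X), (n <= 2 ^ k)%N ->
  (forall i, (i <= n)%N -> N (a i)) ->
  (forall i, (i < n)%N -> mdist (a i) (a i.+1) <= sigma) ->
  forall p, L (a 0%N) (a n) p ->
  exists2 i, (i <= n)%N & mdist p (a i) <= k.+1%:R * D.
Proof.
move=> cp s0 D0; elim=> [|k IHk] n a n2 aN astep p Lp.
  exists 0%N => //; rewrite mul1r; apply: (cp_small cp) Lp; try exact: aN.
  move: n2 aN astep; rewrite expn0; case: n => [|[|//]] _ _ astep.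
    by rewrite mdistxx.
  exact: astep.
have m2 : (n./2 <= 2 ^ k)%N by rewrite -divn2; move: n2; rewrite expnS; lia.
have m2' : (n - n./2 <= 2 ^ k)%N.
  by rewrite -divn2; move: n2; rewrite expnS; lia.
have mn : (n./2 <= n)%N by lia.
have := cp_slim cp (aN 0%N isT) (aN _ (leqnn n)) (aN _ mn) Lp.
move=> [q Lq pq]; suff [i ln qi] : exists2 i, (i <= n)%N & mdist q (a i) <= k.+1%:R * D.
  exists i => //; have := metric_triangle p q (a i); rewrite [k.+2%:R]mulrS; lra.
case: Lq => Lq.
  have [||i ilt qi] := IHk n./2 a m2 _ _ q Lq.
  - by move=> i il; apply: aN; lia.
  - by move=> i il; apply: astep; lia.
  - by exists i => //; lia.
have [|||i ilt qi] := IHk (n - n./2)%N (fun i => a (n./2 + i)%N) m2' _ _ q.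
- by move=> i il; apply: aN; lia.
- by move=> i il; rewrite addnS; apply: astep; lia.
- by rewrite addn0 subnKC.
- by exists (n./2 + i)%N => //; lia.
Qed.

Lemma exp2_dominates_affine (A B : R) : exists k0 : nat, forall k n : nat,
  (k0 <= k)%N -> n%:R <= A * k.+1%:R + B -> (n <= 2 ^ k)%N.
Proof.
pose C := `|A| + `|B|.
have C0 : 0 <= C by rewrite /C addr_ge0.
have [c Cc] : exists c : nat, C <= c%:R.
  by exists (Num.truncn C).+1; have /andP[_ /ltW] := truncn_itv C0.
exists (2 * c + 8)%N => k n kk nA.
have : n%:R <= (c * k.+1)%:R :> R.
  apply: le_trans nA _; rewrite natrM.
  have k1 : 1 <= k.+1%:R :> R by rewrite ler1n.
  have AC : A <= `|A| := ler_norm A.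
  have BC : B <= `|B| := ler_norm B.
  have := normr_ge0 A; have := normr_ge0 B; move: Cc; rewrite /C; nra.
rewrite ler_nat => /leq_trans; apply.
have quad j : (j * j.+1 <= 2 ^ (j + 3))%N.
  elim: j => // j IH; rewrite addSn expnS.
  case: j IH => [|[|j]] IH //.
  have : (j.+3 * j.+4 <= 2 * (j.+2 * j.+3))%N by nia.
  lia.
have e : (k = (k - 3) + 3)%N by lia.
have {2}-> := e; apply: leq_trans (quad (k - 3)%N).
move: kk e; move: (k - 3)%N => j kk e.
by rewrite e; nia.
Qed.

Lemma mdist_steps sigma (a : nat -> X) i n :
  (forall k, (i <= k < i + n)%N -> mdist (a k) (a k.+1) <= sigma) ->
  mdist (a i) (a (i + n)%N) <= n%:R * sigma.
Proof.
elim: n => [|n IHn] st; first by rewrite addn0 mdistxx mul0r.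
have := IHn (fun k h => st k ltac:(lia)).
have := st (i + n)%N ltac:(lia); rewrite addnS -natr1.
have := metric_triangle (a i) (a (i + n)%N) (a (i + n).+1); lra.
Qed.

Lemma quasi_path_sub sigma K N n (a : nat -> X) i m : quasi_path sigma K N n a ->
  (i + m <= n)%N -> quasi_path sigma K N m (fun k => a (i + k)%N).
Proof.
move=> [aN ast aq] imn; split.
- by move=> k km; apply: aN; lia.
- by move=> k km; rewrite addnS; apply: ast; lia.
- move=> k l kl; have := aq (i + k)%N (i + l)%N ltac:(lia).
  by rewrite !natrD; lra.
Qed.

Lemma argmin_nat (f : nat -> R) n : exists2 j, (j <= n)%N &
  forall i, (i <= n)%N -> f j <= f i.
Proof.
elim: n => [|n [j jn jmin]]; first by exists 0%N => // i; rewrite leqn0 => /eqP ->.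
have [le|lt] := lerP (f j) (f n.+1).
  exists j => [|i]; first lia.
  by rewrite leq_eqVlt ltnS => /orP[/eqP ->|/jmin].
exists n.+1 => // i; rewrite leq_eqVlt ltnS => /orP[/eqP ->//|/jmin].
by move/(le_trans (ltW lt)).
Qed.

Lemma first_failure (P : nat -> Prop) n : P 0%N ->
  (forall i, (i <= n)%N -> P i) \/ exists i, [/\ (i < n)%N, P i & ~ P i.+1].
Proof.
move=> P0; elim: n => [|n [all|[i [iln Pi nP]]]].
- by left=> i; rewrite leqn0 => /eqP ->.
- have [Pn|nPn] := pselect (P n.+1); last by right; exists n; split=> //; exact: all.
  by left=> i; rewrite leq_eqVlt => /orP[/eqP ->|/all].
- by right; exists i; split=> //; exact: ltnW.
Qed.

Lemma truncn_bounds (r : R) : 0 <= r -> (Num.truncn r)%:R <= r < (Num.truncn r)%:R + 1.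
Proof. by move=> r0; have := truncn_itv r0; rewrite -natr1. Qed.

(** Strong induction on the number of steps. Let p be a guessed point, a j the point of
    the path nearest to it and r their distance, and compare with the guesses for the
    three parts of the path cut at index distance m from j, where m is about 3 K r.
    The outer parts are at least 2 r away from p, so the induction hypothesis rules
    them out; the middle part has O(r) steps, so [bisection_log] bounds r. *)
Lemma coarse_paths_fellow sigma D K : 0 <= sigma -> 1 <= D -> 1 <= K ->
  exists2 D1, 0 <= D1 & forall N L, coarse_paths sigma D N L ->
  forall n a, quasi_path sigma K N n a -> forall p, L (a 0%N) (a n) p ->
  exists2 i, (i <= n)%N & mdist p (a i) <= D1.
Proof.
move=> s0 D1 K1.
have [k0 k0P] := exp2_dominates_affine (6 * K * D) (24 * K * D + 2 * K + 4).
have k00 : 0 <= k0%:R :> R by [].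
exists ((k0%:R + 5) * D) => [|N L cp]; first by nra.
set D' := (k0%:R + 5) * D.
have D'D : 5 * D <= D' by rewrite /D'; nra.
elim/ltn_ind => n IH a qa p Lp.
have [j jn jmin] := argmin_nat (fun i => mdist p (a i)) n.
exists j => //; rewrite leNgt; apply/negP => RD.
set r := mdist p (a j) in jmin RD.
have r0 : 0 <= r by exact: mdist_ge0.
have [aN ast aq] := qa.
pose m := (Num.truncn (3 * K * r + K)).+1.
have [m1 m2] : 3 * K * r + K <= m%:R /\ m%:R <= 3 * K * r + K + 1.
  have /andP[] := @truncn_bounds (3 * K * r + K) ltac:(nra).
  by rewrite /m -natr1; lra.
have m0 : (0 < m)%N by [].
clearbody m.
(* points of the path at index distance m from j are far from p *)
have far i : (i <= n)%N -> (i + m <= j)%N || (j + m <= i)%N -> 2 * r <= mdist p (a i).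
  move=> iln ij; suff : 3 * r <= mdist (a i) (a j).
    have := metric_triangle (a i) p (a j); rewrite (metric_sym (a i) p) -/r.
    by lra.
  have h : m%:R <= K * mdist (a i) (a j) + K.
    case/orP: ij => ij.
      have := aq i j ltac:(clear -ij jn; lia); have : (i + m)%:R <= j%:R :> R by rewrite ler_nat.
      by rewrite natrD; lra.
    have := aq j i ltac:(clear -ij iln; lia); have : (j + m)%:R <= i%:R :> R by rewrite ler_nat.
    by rewrite natrD metric_sym; lra.
  have : 3 * K * r + K <= K * mdist (a i) (a j) + K by lra.
  by have := mdist_ge0 (a i) (a j); nra.
have [i1 i1E] : exists i, i = (j - m)%N by exists (j - m)%N.
have [i2 i2E] : exists i, i = minn n (j + m) by exists (minn n (j + m)).
have i1n : (i1 <= n)%N by clear -i1E jn; lia.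
have i2n : (i2 <= n)%N by clear -i2E; lia.
have left_i i : (0 < i1 -> i <= i1 -> (i <= n) && (i + m <= j))%N.
  by clear -i1E i1n; lia.
have right_i i : (i2 != n -> i2 <= i <= n -> j + m <= i)%N.
  by clear -i2E i2n; lia.
have len12 : (i2 - i1 <= m + m)%N /\ (i1 <= i2)%N.
  by clear -i1E i2E jn; lia.
have i1lt : (0 < i1 -> i1 < n)%N by clear -i1E jn m0; lia.
have i2gt : (i2 != n -> n - i2 < n)%N by clear -i2E m0 i2n; lia.
clear i1E i2E.
have end_contra q i : (i <= n)%N -> mdist p q <= 2 * D -> mdist q (a i) <= D -> False.
  move=> iln pq qi; have := jmin i iln; have := metric_triangle p q (a i).
  by rewrite -/r; lra.
have [q1 Lq1 pq1] := cp_slim cp (aN 0%N isT) (aN _ (leqnn n)) (aN _ i1n) Lp.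
case: Lq1 => Lq1.
  have [i10|i10] := posnP i1.
    apply: (end_contra q1 0%N) => //; first lra.
    move: Lq1; rewrite i10 => Lq1.
    by apply: (cp_small cp) Lq1; [exact: aN|exact: aN|rewrite mdistxx].
  have [|i ii1 qi] := IH i1 _ _ (quasi_path_sub (i := 0%N) (m := i1) qa i1n) q1 Lq1.
    exact: i1lt.
  rewrite add0n in qi; have /andP[iln im] := left_i i i10 ii1.
  have := far i iln; rewrite im => /(_ isT); have := metric_triangle p q1 (a i); lra.
have [q Lq q1q] := cp_slim cp (aN _ i1n) (aN _ (leqnn n)) (aN _ i2n) Lq1.
have pq : mdist p q <= 2 * D by have := metric_triangle p q1 q; lra.
case: Lq => Lq; last first.
  have [i2e|i2e] := eqVneq i2 n.
    apply: (end_contra q n) => //.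
    move: Lq; rewrite i2e => Lq.
    by apply: (cp_small cp) Lq; [exact: aN|exact: aN|rewrite mdistxx].
  have [|||i ii1 qi] := IH (n - i2)%N _ _ (quasi_path_sub (i := i2) (m := n - i2) qa _) q.
  - exact: i2gt.
  - by rewrite subnKC.
  - by rewrite addn0 subnKC.
  have iin : (i2 <= i2 + i <= n)%N by rewrite leq_addr -leq_subRL.
  have := far (i2 + i)%N; rewrite (right_i _ i2e iin) orbT.
  case/andP: iin => _ -> /(_ isT isT).
  have := metric_triangle p q (a (i2 + i)%N); lra.
(* the middle part is short compared to an exponential of r *)
pose t := Num.truncn (r / D).
have /andP[t1 t2] := @truncn_bounds (r / D) ltac:(by apply: divr_ge0 => //; lra).
rewrite -/t in t1 t2.
have rD : r = r / D * D by rewrite divfK //; lra.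
have tk : (k0 + 4 < t)%N.
  have h : k0%:R + 5 < t%:R + 1 :> R.
    apply: le_lt_trans t2; rewrite ler_pdivlMr; [exact: ltW RD | lra].
  have : ((k0 + 5)%:R < (t + 1)%:R :> R) by rewrite !natrD.
  by rewrite ltr_nat; clear; lia.
pose k := (t - 4)%N.
have kt : t%:R = k%:R + 4 :> R by rewrite -natrD /k subnK //; clear -tk; lia.
have ki : (i2 - i1 <= 2 ^ k)%N.
  apply: k0P; first by rewrite /k; clear -tk; lia.
  have im : (i2 - i1)%:R <= (m + m)%:R :> R by rewrite ler_nat; case: len12.
  apply: le_trans im _; rewrite natrD -natr1.
  have rk : r <= (k%:R + 5) * D by rewrite rD; nra.
  have : K * r <= K * ((k%:R + 5) * D) by rewrite ler_wpM2l //; lra.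
  by move: m2; lra.
have [|||i ii qi] := bisection_log cp s0 ltac:(lra) (a := fun i => a (i1 + i)%N) ki
  _ _ (p := q).
- by move=> i ii; apply: aN; clear -ii len12 i2n; lia.
- by move=> i ii; rewrite addnS; apply: ast; clear -ii len12 i2n; lia.
- by rewrite addn0 subnKC //; case: len12.
have := jmin (i1 + i)%N ltac:(clear -ii len12 i2n; lia); have := metric_triangle p q (a (i1 + i)%N).
rewrite -/r => h1 h2; move: qi; rewrite -natr1 => qi.
have : r <= (k%:R + 3) * D by lra.
by rewrite rD; nra.
Qed.

Lemma coarse_pathsW sigma D D' N L : D <= D' -> coarse_paths sigma D N L ->
  coarse_paths sigma D' N L.
Proof.
move=> DD [cc cs sl]; split.
- move=> x y Nx Ny; have [n [c [c0 cn cL cst]]] := cc x y Nx Ny.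
  exists n, c; split=> // i iln; first exact: near_setW (cL i iln).
  exact: le_trans (cst i iln) DD.
- by move=> x y p Nx Ny xy Lp; apply: le_trans (cs x y p Nx Ny xy Lp) DD.
- by move=> x y z Nx Ny Nz p /(sl x y z Nx Ny Nz); apply: near_setW.
Qed.

(** The converse closeness uses connectedness: on the way from one end to the other,
    the points of the guess pass from being close to the first part of the path to
    being close to the second part, so they pass near every point of the path. *)
Theorem coarse_paths_stability sigma D K : 0 <= sigma -> 0 <= D -> 0 <= K ->
  exists2 D', 0 <= D' & forall N L, coarse_paths sigma D N L ->
  forall n a, quasi_path sigma K N n a ->
    (forall p, L (a 0%N) (a n) p -> exists2 i, (i <= n)%N & mdist p (a i) <= D') /\
    (forall i, (i <= n)%N -> near_set D' (L (a 0%N) (a n)) (a i)).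
Proof.
move=> s0 D0 K0; have [||D1 D10 fel] := @coarse_paths_fellow sigma (D + 1) (K + 1) s0.
- lra.
- lra.
pose E := 2 * D + D1.
exists (D1 + (D + E + (2 * K * E + K) * sigma)) => [|N L cp n a qa].
  have E0 : 0 <= E by rewrite /E; lra.
  have := mulr_ge0 (addr_ge0 (mulr_ge0 K0 E0) K0) s0; have := mulr_ge0 (mulr_ge0 K0 E0) s0.
  by nra.
have E0 : 0 <= E by rewrite /E; lra.
have Ks0 : 0 <= (2 * K * E + K) * sigma.
  by apply: mulr_ge0 => //; have := mulr_ge0 K0 E0; lra.
have felp p : L (a 0%N) (a n) p -> exists2 i, (i <= n)%N & mdist p (a i) <= D1.
  apply: (fel N L (coarse_pathsW _ cp)); first lra.
  case: qa => aN ast aq; split=> // i j ij.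
  by have := aq i j ij; have := mdist_ge0 (a i) (a j); nra.
split=> [p Lp|j jn].
  by have [i iln pi] := felp p Lp; exists i => //; lra.
case: (qa) => aN ast aq.
have [m [c [c0 cm cL cst]]] := cp_connected cp (aN 0%N isT) (aN n (leqnn n)).
have cnear k : (k <= m)%N -> exists2 i, (i <= n)%N & mdist (c k) (a i) <= D + D1.
  move=> km; have [q Lq cq] := cL k km; have [i iln qi] := felp q Lq.
  by exists i => //; have := metric_triangle (c k) q (a i); lra.
have [k [i [i' [km [ij ji' i'n] h1 h2]]]] : exists k i i',
  [/\ (k <= m)%N, [/\ (i <= j)%N, (j <= i')%N & (i' <= n)%N],
     mdist (c k) (a i) <= E & mdist (c k) (a i') <= E].
  pose P k := exists2 i, (i <= j)%N & mdist (c k) (a i) <= D + D1.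
  have P0 : P 0%N by exists 0%N => //; rewrite c0 mdistxx; lra.
  have [allP|[k [km [i ij ci] nP]]] := first_failure m P0.
    have [i ij ci] := allP m (leqnn m).
    exists m, i, n; split=> //; first by rewrite /E; lra.
    by rewrite cm mdistxx.
  have [i' i'n ci'] := cnear k.+1 km.
  have ji' : (j < i')%N by rewrite ltnNge; apply/negP => h; apply: nP; exists i'.
  exists k, i, i'; split=> //; first exact: ltnW.
  - by split=> //; exact: ltnW.
  - by rewrite /E; lra.
  - have := metric_triangle (c k) (c k.+1) (a i'); have := cst k km.
    by rewrite /E; lra.
have dii : mdist (a i) (a i') <= 2 * E.
  by have := metric_triangle (a i) (c k) (a i'); have := metric_sym (a i) (c k); lra.
have Kd : K * mdist (a i) (a i') <= K * (2 * E) by rewrite ler_wpM2l.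
have dij : mdist (a i) (a j) <= (2 * K * E + K) * sigma.
  have -> : j = (i + (j - i))%N by rewrite subnKC.
  apply: le_trans (mdist_steps _) _; first by move=> l hl; apply: ast; clear -hl jn ij; lia.
  rewrite ler_wpM2r // natrB //.
  have := aq i i' ltac:(clear -ij ji' i'n; lia).
  have : j%:R <= i'%:R :> R by rewrite ler_nat.
  by lra.
apply: (@near_setW (E + (2 * K * E + K) * sigma + D) _ (L (a 0%N) (a n))) => //.
  by rewrite /E; lra.
apply: near_set_dist (cL k km).
have := metric_triangle (a j) (a i) (c k); have := metric_sym (a j) (a i).
have := metric_sym (a i) (c k).
by lra.
Qed.

End stability.

(** * Hyperbolic pieces *)

Section pieces.
Context {R : realType} {X : metricType R}.
Variables (delta : R) (eta : R -> R).
Hypothesis delta0 : 0 <= delta.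
Hypothesis eta0 : forall r : R, 0 <= r -> 0 <= eta r.
Implicit Types (A N : set X) (x y z p q o : X) (r s t : R).

(** The path metric of A is only compared with the metric of X; the constants delta
    and eta are the same for all pieces. *)
Record piece A : Prop := Piece {
  pc_geodesic : geodesic_space A (path_dist A);
  pc_slim : slim_triangles delta A (path_dist A);
  pc_dist : forall x y, A x -> A y -> mdist x y <= path_dist A x y;
  pc_proper : proper_embedding eta A (path_dist A) mdist id }.

(** All geodesics of A from x to y together, which avoids choosing one. *)
Definition seg A x y : set X :=
  [set p | exists2 g, is_geodesic A (path_dist A) x y g
                    & side (path_dist A) x y g p].

Section one_piece.
Variable A : set X.
Hypothesis pA : piece A.
Local Notation d := (path_dist A).

Lemma path_dist_ge0 x y : A x -> A y -> 0 <= d x y.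
Proof. by move=> Ax Ay; apply: le_trans (mdist_ge0 x y) (pc_dist pA Ax Ay). Qed.

Lemma geodesic_at x y g s t : is_geodesic A d x y g ->
  0 <= s -> s <= t -> t <= d x y -> d (g s) (g t) = t - s.
Proof.
move=> [_ _ _ gd] s0 st tl; rewrite gd ?s0 ?(le_trans st) ?(le_trans s0) //.
by rewrite distrC ger0_norm // subr_ge0.
Qed.

Lemma path_dist_sym x y : A x -> A y -> d x y = d y x.
Proof.
move=> Ax Ay; have [g [g0 gl gA gd]] := pc_geodesic pA Ax Ay.
have l0 := path_dist_ge0 Ax Ay.
have := gd (d x y) 0; rewrite !lexx l0 gl g0 => /(_ isT isT) ->.
by rewrite subr0 ger0_norm.
Qed.

Lemma geodesic_rev x y g : A x -> A y -> is_geodesic A d x y g ->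
  is_geodesic A d y x (fun s => g (d x y - s)).
Proof.
move=> Ax Ay [g0 gl gA gd]; rewrite /is_geodesic -(path_dist_sym Ax Ay); split.
- by rewrite subr0.
- by rewrite subrr.
- by move=> s h; apply: gA; lra.
- move=> s t hs ht; rewrite gd; [|lra|lra].
  by rewrite (distrC s); congr `|_|; lra.
Qed.

Lemma geodesic_sub x y g s t : is_geodesic A d x y g ->
  0 <= s -> s <= t -> t <= d x y ->
  is_geodesic A d (g s) (g t) (fun u => g (s + u)).
Proof.
move=> gg s0 st tl; have e := geodesic_at gg s0 st tl.
case: gg => [g0 gl gA gd]; rewrite /is_geodesic e; split.
- by rewrite addr0.
- by rewrite addrC subrK.
- by move=> u h; apply: gA; lra.
- move=> u v hu hv; rewrite gd; [|lra|lra].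
  by congr `|_|; lra.
Qed.

Lemma seg_in x y : seg A x y `<=` A.
Proof. by move=> p [g [_ _ gA _] [s /= sl <-]]; apply: gA. Qed.

Lemma seg_sym x y p : A x -> A y -> seg A x y p -> seg A y x p.
Proof.
move=> Ax Ay [g gg [s /= sl <-]]; exists (fun s => g (d x y - s)).
  exact: geodesic_rev.
exists (d x y - s) => /=; first by rewrite -(path_dist_sym Ax Ay); lra.
by congr g; lra.
Qed.

Lemma seg_l x y : A x -> A y -> seg A x y x.
Proof.
move=> Ax Ay; have [g gg] := pc_geodesic pA Ax Ay; exists g => //.
by exists 0; [rewrite /= lexx path_dist_ge0|case: gg].
Qed.

Lemma seg_r x y : A x -> A y -> seg A x y y.
Proof. by move=> Ax Ay; apply: seg_sym => //; apply: seg_l. Qed.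

Lemma seg_slim x y z p : A x -> A y -> A z -> seg A x y p ->
  near_set delta (seg A x z `|` seg A z y) p.
Proof.
move=> Ax Ay Az [f gf fp].
have [g gg] := pc_geodesic pA Ay Az; have [h gh] := pc_geodesic pA Az Ax.
have [q qgh pq] := pc_slim pA Ax Ay Az gf gg gh fp.
exists q; last first.
  apply: le_trans pq; apply: (pc_dist pA).
    by case: fp => s sl <-; case: gf => _ _ + _; apply.
  by case: qgh => -[s sl <-]; [case: gg|case: gh] => _ _ + _; apply.
by case: qgh => qg; [right|left]; apply: seg_sym => //; [exists g|exists h].
Qed.

Lemma seg_small r x y p : A x -> A y -> 0 <= r -> mdist x y <= r ->
  seg A x y p -> mdist p x <= eta r.
Proof.
move=> Ax Ay r0 xy [g gg [s /= /andP[s0 sl] <-]].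
have [g0 _ gA gd] := gg.
have l : d x y <= eta r := pc_proper pA Ax Ay r0 xy.
rewrite metric_sym -[X in mdist X _]g0; apply: le_trans (pc_dist pA _ _) _.
- by apply: gA; rewrite lexx; lra.
- by apply: gA; rewrite s0.
- by rewrite (geodesic_at gg) ?lexx //; lra.
Qed.

Lemma seg_connected x y : A x -> A y -> exists n (c : nat -> X),
  [/\ c 0%N = x, c n = y, forall i, seg A x y (c i)
    & forall i, mdist (c i) (c i.+1) <= 1].
Proof.
move=> Ax Ay; have [g gg] := pc_geodesic pA Ax Ay.
have l0 := path_dist_ge0 Ax Ay; have [g0 gl gA gd] := gg.
have minb i : 0 <= Num.min i%:R (d x y) <= d x y.
  by rewrite ge_min lexx orbT andbT le_min l0 ler0n.
exists (Num.truncn (d x y)).+1, (fun i => g (Num.min i%:R (d x y))); split.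
- by rewrite min_l.
- rewrite min_r //; have /andP[_] := truncn_bounds l0.
  by rewrite natr1 => /ltW.
- by move=> i; exists g => //; exists (Num.min i%:R (d x y)) => //=; exact: minb.
- move=> i; apply: le_trans (pc_dist pA _ _) _; try by apply: gA.
  have le : Num.min i%:R (d x y) <= Num.min i.+1%:R (d x y).
    by rewrite le_min !ge_min lexx ler_nat leqnSn orbT.
  have /andP[a1 a2] := minb i; have /andP[b1 b2] := minb i.+1.
  rewrite (geodesic_at gg) // lerBlDr.
  rewrite -natr1 minElt; case: ltP => h; rewrite minElt; case: ltP => h'; lra.
Qed.

(** A geodesic does not come back: if the initial part of a geodesic to y, up to o,
    comes close to y, then o is close to y. The bound eta turns closeness in X into
    closeness of parameters. *)
Lemma seg_between r x y o q : A x -> A y -> 0 <= r ->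
  seg A x y o -> seg A x o q -> mdist q y <= r ->
  mdist o y <= eta (r + delta) + (eta 0 + delta + r).
Proof.
move=> Ax Ay r0 [g gg [s /= /andP[s0 sl] os]] qo qy.
have Ao : A o by rewrite -os; case: gg => _ _ + _; apply; rewrite s0.
have [g0 gl gA gd] := gg.
have g1 := geodesic_sub gg (lexx 0) s0 sl; rewrite g0 os in g1.
have e1 : d x o = s by rewrite -os -[X in d X]g0 (geodesic_at gg) ?lexx // subr0.
case: qo => f gf fq.
have [h1 gh1] := pc_geodesic pA Ao Ao; have gr := geodesic_rev Ax Ao g1.
have [q' qgh qq'] := pc_slim pA Ax Ao Ao gf gh1 gr fq.
have Aq : A q by case: fq => u ul <-; case: gf => _ _ + _; apply.
have Aq' : A q'.
  by case: qgh => -[u ul <-]; [case: gh1|case: gr] => _ _ + _; apply.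
have dqq' : mdist q q' <= delta := le_trans (pc_dist pA Aq Aq') qq'.
have dq'y : mdist q' y <= r + delta.
  by have := metric_triangle q' q y; rewrite (metric_sym q' q); lra.
have er : 0 <= eta (r + delta) by apply: eta0; exact: addr_ge0.
have e0 : 0 <= eta 0 by apply: eta0.
have d0 := delta0.
case: qgh => qh.
  have h0 : mdist q' o <= eta 0.
    by apply: (@seg_small 0 o o) => //; [rewrite mdistxx|exists h1].
  by have := metric_triangle o q' y; rewrite (metric_sym o q'); lra.
case: qh => u /=; rewrite -(path_dist_sym Ax Ao) e1 add0r => /andP[u0 us] q'E.
have {}u0 : (0 : R) <= u := u0; have {}us : (u : R) <= s := us.
have h : d q' y <= eta (r + delta).
  exact: (pc_proper pA Aq' Ay (addr_ge0 r0 delta0) dq'y).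
have e2 : d q' y = d x y - (s - u).
  by rewrite -q'E -[X in d _ X]gl (geodesic_at gg) //; lra.
have e3 : d o y = d x y - s by rewrite -os -[X in d _ X]gl (geodesic_at gg) //; lra.
have h3 := pc_dist pA Ao Ay.
have h4 : d o y <= eta (r + delta).
  rewrite e3; have h5 : d x y - (s - u) <= eta (r + delta) by rewrite -e2.
  by lra.
by apply: le_trans h3 _; apply: le_trans h4 _; rewrite lerDl !addr_ge0.
Qed.

Lemma seg_sub x y o q : A x -> A y -> seg A x y o -> seg A x o q ->
  near_set (delta + eta 0) (seg A x y) q.
Proof.
move=> Ax Ay oxy; have [g gg [s /= /andP[s0 sl] os]] := oxy => qo.
have Ao : A o by rewrite -os; case: gg => _ _ + _; apply; rewrite s0.
have [g0 gl gA gd] := gg.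
have g1 := geodesic_sub gg (lexx 0) s0 sl; rewrite g0 os in g1.
have e1 : d x o = s by rewrite -os -[X in d X]g0 (geodesic_at gg) ?lexx // subr0.
case: qo => f gf fq.
have [h1 gh1] := pc_geodesic pA Ao Ao; have gr := geodesic_rev Ax Ao g1.
have [q' qgh qq'] := pc_slim pA Ax Ao Ao gf gh1 gr fq.
have Aq : A q by case: fq => u ul <-; case: gf => _ _ + _; apply.
have Aq' : A q'.
  by case: qgh => -[u ul <-]; [case: gh1|case: gr] => _ _ + _; apply.
have dqq' : mdist q q' <= delta := le_trans (pc_dist pA Aq Aq') qq'.
have e0 : 0 <= eta 0 by apply: eta0.
have d0 := delta0.
case: qgh => qh.
  have h0 : mdist q' o <= eta 0.
    by apply: (@seg_small 0 o o) => //; [rewrite mdistxx|exists h1].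
  by exists o => //; have := metric_triangle q q' o; lra.
exists q'; last lra.
exists g => //; case: qh => u /=; rewrite -(path_dist_sym Ax Ao) e1 => ul <-.
by exists (0 + (s - u)) => //=; lra.
Qed.

Lemma piece_coarse_paths sigma N : 0 <= sigma -> N `<=` A ->
  coarse_paths sigma (1 + delta + eta sigma) N (seg A).
Proof.
move=> s0 NA; have es := eta0 s0; have d0 := delta0; split.
- move=> x y /NA Ax /NA Ay; have [n [c [c0 cn cs cst]]] := seg_connected Ax Ay.
  exists n, c; split=> // i _; first by apply: near_set0; [lra|].
  by have := cst i; lra.
- move=> x y p /NA Ax /NA Ay xy h; have := seg_small Ax Ay s0 xy h; lra.
- move=> x y z /NA Ax /NA Ay /NA Az p /(seg_slim Ax Ay Az).
  by apply: near_setW => //; lra.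
Qed.

Lemma seg_near_ends r x y x' y' p : A x -> A y -> A x' -> A y' ->
  0 <= r -> mdist x x' <= r -> mdist y y' <= r -> seg A x y p ->
  near_set (2 * delta + eta r + r) (seg A x' y') p.
Proof.
move=> Ax Ay Ax' Ay' r0 xx yy pxy; have er := eta0 r0; have d0 := delta0.
have [q [qs|qs] pq] := seg_slim Ax Ay Ax' pxy.
  have := seg_small Ax Ax' r0 xx qs => qx.
  exists x'; first exact: seg_l.
  by have := metric_triangle p q x'; have := metric_triangle q x x'; lra.
have [q' [q's|q's] qq'] := seg_slim Ax' Ay Ay' qs.
  by exists q' => //; have := metric_triangle p q q'; lra.
have h := seg_small Ay' Ay r0 (_ : mdist y' y <= r) q's.
rewrite metric_sym in h; exists y'; first exact: seg_r.
by have := h yy; have := metric_triangle p q y'; have := metric_triangle q q' y'; lra.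
Qed.

End one_piece.
End pieces.

(** * Simplicial trees *)

Section betweenness.
Context {R : realType} {T : metricType R}.
Implicit Types (a b c x y z t : T).

Lemma segment_sym a c b : segment a c b -> segment c a b.
Proof.
rewrite /segment /= => h; rewrite (metric_sym c b) (metric_sym b a) (metric_sym c a).
by rewrite addrC.
Qed.

Lemma segment_l a c : segment a c a.
Proof. by rewrite /segment /= mdistxx add0r. Qed.

Lemma segment_r a c : segment a c c.
Proof. by rewrite /segment /= mdistxx addr0. Qed.

(** [segment a c b] says that b lies between a and c; the endpoints come first. *)
Lemma segment_trans a b c x : segment a c b -> segment a b x ->
  segment a c x /\ segment x c b.
Proof.
rewrite /segment /= => h1 h2.
by have := metric_triangle a x c; have := metric_triangle x b c; split; lra.
Qed.

Lemma segment_trans_right a b c x : segment a c b -> segment b c x ->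
  segment a x b /\ segment a c x.
Proof.
move=> /segment_sym h1 /segment_sym h2; have [h3 h4] := segment_trans h1 h2.
by split; exact: segment_sym.
Qed.

Lemma segment_eq a b : segment a a b -> b = a.
Proof.
rewrite /segment /= mdistxx metric_sym => h; apply: mdist_positivity.
by have := mdist_ge0 b a; lra.
Qed.

Lemma segment_anti a b c : segment a b c -> segment a c b -> b = c.
Proof.
rewrite /segment /= => h1 h2; apply: mdist_positivity.
have := mdist_ge0 b c; have := metric_sym b c; lra.
Qed.

Lemma geodesic_segment x y g (s : R) : is_geodesic [set: T] mdist x y g ->
  0 <= s <= mdist x y -> segment x y (g s) /\ mdist x (g s) = s.
Proof.
move=> [g0 gl _ gd] sl; have l0 := mdist_ge0 x y; have /andP[s0 s1] := sl.
have e1 : mdist x (g s) = s.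
  rewrite -[X in mdist X]g0 gd // ?lexx ?l0 // sub0r normrN ger0_norm //.
have e2 : mdist (g s) y = mdist x y - s.
  rewrite -[X in mdist _ X]gl gd // ?lexx ?l0 // distrC ger0_norm // subr_ge0 //.
by split=> //; rewrite /segment /= e1 e2; lra.
Qed.
End betweenness.

Lemma ivt_locally_lipschitz (R : realType) (f : R -> R) (l c : R) : 0 <= l ->
  (forall s, 0 <= s <= l -> exists2 r : R, 0 < r & forall s', 0 <= s' <= l ->
     `|s - s'| < r -> `|f s - f s'| <= `|s - s'|) ->
  Num.min (f 0) (f l) <= c <= Num.max (f 0) (f l) ->
  exists2 s, 0 <= s <= l & f s = c.
Proof.
move=> l0 fl cb; suff [s sl <-] : exists2 s, s \in `[0, l] & f s = c.
  by exists s => //; move: sl; rewrite in_itv.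
apply: IVT => //; apply/subspace_continuousP => s /=; rewrite in_itv /= => sl.
have [r r0 fr] := fl s sl.
apply/cvgrPdist_lt => e e0; rewrite near_withinE.
apply/nbhs_ballP; exists (Num.min r e); first by rewrite /= lt_min r0 e0.
move=> t; rewrite /ball /= lt_min => /andP[tr te]; rewrite in_itv /= => tl.
exact: le_lt_trans (fr t tl tr) te.
Qed.

Section tree.
Context {R : realType} {T : metricType R}.
Variable V : set T.
Hypothesis treeV : simplicial_tree V.
Implicit Types (a b u v w x y z t p : T).

Lemma vertex_edge_end a a' t : adjacent V a a' -> segment a a' t -> V t ->
  t = a \/ t = a'.
Proof.
move=> [Va Va' aa] st Vt; have [->|/eqP nta] := eqVneq t a; first by left.
have [->|/eqP nta'] := eqVneq t a'; first by right.
have h1 := st_separated treeV Va Vt (fun e => nta (esym e)).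
have h2 := st_separated treeV Vt Va' nta'.
by exfalso; move: st; rewrite /segment /= aa; lra.
Qed.

Lemma adjacent_sym a a' : adjacent V a a' -> adjacent V a' a.
Proof. by move=> [Va Va' aa]; split=> //; rewrite metric_sym. Qed.

Lemma vertex_adjacent_neq a a' : adjacent V a a' -> a <> a'.
Proof. by move=> [_ _ aa] e; move: aa; rewrite e mdistxx; lra. Qed.

Lemma edge_dist a a' s t : adjacent V a a' -> segment a a' s -> segment a a' t ->
  mdist s t = `|mdist a s - mdist a t|.
Proof.
move=> aa ss st; have [c [c0 cl cT cd] cs] := st_edge treeV aa.
have [_ _ a1] := aa.
move: ss st; rewrite cs => -[i /= il <-] [j /= jl <-].
have e k : 0 <= k <= mdist a a' -> mdist a (c k) = k.
  move=> /andP[k0 kl]; rewrite -[X in mdist X]c0 cd ?lexx ?k0 ?kl ?a1 ?ler01 //.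
  by rewrite sub0r normrN ger0_norm.
by rewrite !e // cd.
Qed.

Lemma edge_at a a' (s : R) : adjacent V a a' -> 0 <= s <= 1 ->
  exists2 t, segment a a' t & mdist a t = s.
Proof.
move=> aa sl; have [c gc _] := st_edge treeV aa.
have [_ _ a1] := aa; rewrite -a1 in sl.
by have [h1 h2] := geodesic_segment gc sl; exists (c s).
Qed.

Lemma edge_point_eq a a' s t : adjacent V a a' -> segment a a' s ->
  segment a a' t -> mdist a s = mdist a t -> s = t.
Proof.
move=> aa ss st e; apply: mdist_positivity.
by rewrite (edge_dist aa ss st) e subrr normr0.
Qed.

(** A ball of radius 1/2 around a vertex consists of parts of edges at that vertex,
    because the nearer end of any other edge would be a second vertex at distance
    less than 1. *)
Lemma star_ball t t' : V t -> mdist t t' < 1 / 2 ->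
  t' = t \/ exists2 a, adjacent V t a & segment t a t'.
Proof.
move=> Vt tt'; have [Vt'|[a [a' [aa st']]]] := st_cover treeV t'.
  left; have [//|/eqP ne] := eqVneq t' t.
  by exfalso; have := st_separated treeV Vt Vt' (fun e => ne (esym e)); lra.
have [Va Va' a1] := aa; have := st'; rewrite /segment /= a1 => e.
right; have [h|h] := lerP (mdist a t') (1 / 2).
  have [ta|/eqP ne] := eqVneq t a; first by exists a'; rewrite ta.
  exfalso; have := st_separated treeV Vt Va ne; have := metric_triangle t t' a.
  by have := metric_sym t' a; lra.
have [ta|/eqP ne] := eqVneq t a'.
  by exists a; rewrite ta; [exact: adjacent_sym|exact: segment_sym].
exfalso; have := st_separated treeV Vt Va' ne; have := metric_triangle t t' a'; lra.
Qed.

Lemma edge_interiorP a a' t : adjacent V a a' -> segment a a' t -> ~ V t ->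
  edge_interior a a' t.
Proof.
move=> [Va Va' _] st nVt; split=> //= -[e|e]; apply: nVt; rewrite e //.
Qed.

Lemma edge_interior_novertex a a' t : adjacent V a a' -> edge_interior a a' t -> ~ V t.
Proof.
move=> aa [st nt] Vt; apply: nt.
by have [->|->] := vertex_edge_end aa st Vt; [left|right].
Qed.

Section edge.
Variables v w : T.
Hypothesis vw : adjacent V v w.

Let is_edge a a' := (v = a /\ w = a') \/ (v = a' /\ w = a).

(** The vertices that stay connected to v when the edge from v to w is removed. *)
Definition near_side a : Prop :=
  exists2 p, simple_edge_path V v a p & w \notin p.

Lemma near_side_v : near_side v.
Proof. by exists [::]. Qed.

Lemma near_side_w : ~ near_side w.
Proof.
move=> [p [_ lp _]]; case: p lp => [|x p] /= lp.
  by case: (vertex_adjacent_neq vw).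
by rewrite -lp mem_last.
Qed.

(** This is where uniqueness of simple paths is used: a simple path from v that
    avoids w and could be prolonged to w would compete with the edge itself. *)
Lemma near_side_adjacent a a' : adjacent V a a' -> ~ is_edge a a' ->
  near_side a -> near_side a'.
Proof.
move=> aa nE [p [pp lp up] wp].
have [e|/eqP va'] := eqVneq a' v; first by rewrite e; exact: near_side_v.
case: (boolP (a' \in p)) => a'p.
  case/splitPr: a'p pp lp up wp => p1 p2 pp _ up wp; exists (rcons p1 a').
    split; last 1 first.
    - move: up; rewrite -cat_rcons -cat_cons cat_uniq => /and3P[+ _ _] //.
    - by move: pp; rewrite -cat_rcons cat_path => /andP[].
    - by rewrite last_rcons.
  by move: wp; rewrite -cat_rcons mem_cat negb_or => /andP[].
have sp : simple_edge_path V v a' (rcons p a').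
  split; last 1 first.
  - rewrite -rcons_cons rcons_uniq up andbT inE negb_or a'p andbT.
    by apply/eqP.
  - by rewrite rcons_path pp /= lp; apply/asboolP.
  - by rewrite last_rcons.
exists (rcons p a') => //; rewrite mem_rcons inE negb_or wp andbT.
apply/eqP => wa'; apply: nE; left; split=> //.
have [Vv Vw _] := vw.
have [p0 [_ p0u]] := st_tree treeV Vv Vw.
have h1 : p0 = [:: w].
  apply: p0u; split=> //=; first by rewrite andbT; apply/asboolP.
  by rewrite inE andbT; apply/eqP; exact: vertex_adjacent_neq vw.
have h2 : p0 = rcons p a' by apply: p0u; rewrite wa'.
move: h2 lp; rewrite h1; case: (p) => [|x [|]] //=.
Qed.

Lemma near_side_edge a a' : adjacent V a a' -> ~ is_edge a a' ->
  (near_side a <-> near_side a').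
Proof.
move=> aa nE; split; apply: near_side_adjacent => //; first exact: adjacent_sym.
by move=> [[e1 e2]|[e1 e2]]; apply: nE; [right|left].
Qed.

Definition far_side t : Prop := exists a, [/\ V a, ~ near_side a
  & t = a \/ exists2 a', adjacent V a a' & segment a a' t].

(** The parameter on the edge to which the tree retracts: 0 on the side of v and 1 on
    the side of w. *)
Definition edge_coord t : R :=
  if `[< segment v w t >] then mdist v t else if `[< far_side t >] then 1 else 0.

Lemma edge_coord_edge t : segment v w t -> edge_coord t = mdist v t.
Proof. by move=> st; rewrite /edge_coord asboolT. Qed.

Lemma edge_coord_vertex t : V t ->
  edge_coord t = if `[< near_side t >] then 0 else 1.
Proof.
move=> Vt; rewrite /edge_coord; case: asboolP => st.
  have [e|e] := vertex_edge_end vw st Vt.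
    by rewrite e mdistxx asboolT //; exact: near_side_v.
  by rewrite e asboolF; [case: vw|exact: near_side_w].
case: (asboolP (near_side t)) => nt; last first.
  by rewrite asboolT //; exists t; split=> //; left.
rewrite asboolF // => -[a [Va na [e|[a' aa sa]]]]; first by apply: na; rewrite -e.
have [e|e] := vertex_edge_end aa sa Vt; first by apply: na; rewrite -e.
have [[[e1 e2]|[e1 e2]]|nE] := pselect (is_edge a a').
- by apply: st; rewrite e -e2; exact: segment_r.
- by apply: st; rewrite e -e1; exact: segment_l.
- by apply: na; apply/(near_side_edge aa nE); rewrite -e.
Qed.

Lemma edge_coord_off a a' t : adjacent V a a' -> ~ is_edge a a' -> segment a a' t ->
  edge_coord t = edge_coord a.
Proof.
move=> aa nE st; have [Va Va' _] := aa; rewrite (edge_coord_vertex Va).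
have [Vt|nVt] := pselect (V t).
  rewrite (edge_coord_vertex Vt).
  have [->//|->] := vertex_edge_end aa st Vt.
  by rewrite (asbool_equiv_eq (near_side_edge aa nE)).
have it := edge_interiorP aa st nVt.
rewrite /edge_coord asboolF; last first.
  move=> svw; apply: nE; apply: (st_disjoint treeV vw aa _ it).
  exact: edge_interiorP.
case: (asboolP (near_side a)) => na; last first.
  by rewrite asboolT //; exists a; split=> //; right; exists a'.
rewrite asboolF // => -[b [Vb nb [e|[b' bb sb]]]].
  by apply: nVt; rewrite e.
have ib := edge_interiorP bb sb nVt.
have [[e1 e2]|[e1 e2]] := st_disjoint treeV aa bb it ib.
  by apply: nb; rewrite -e1.
by apply: nb; rewrite -e2; apply/(near_side_edge aa nE).
Qed.

Lemma is_edge_segment a a' : is_edge a a' -> segment a a' = segment v w.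
Proof.
move=> [[<- <-]//|[<- <-]].
by apply/seteqP; split=> t; exact: segment_sym.
Qed.

(** Continuity of the retraction. At a vertex it relies on [star_ball], since
    infinitely many edges may meet there. *)
Lemma edge_coord_local t : exists2 r : R, 0 < r & forall t', mdist t t' < r ->
  `|edge_coord t - edge_coord t'| <= mdist t t'.
Proof.
have both x y : segment v w x -> segment v w y ->
    `|edge_coord x - edge_coord y| <= mdist x y.
  by move=> sx sy; rewrite !edge_coord_edge // (edge_dist vw sx sy).
have [Vt|nVt] := pselect (V t).
  exists (1 / 2); first lra.
  move=> t' tt'; have [->|[a aa sa]] := star_ball Vt tt'.
    by rewrite subrr normr0 mdistxx.
  have [E|nE] := pselect (is_edge t a).
    by apply: both; rewrite -(is_edge_segment E) //; exact: segment_l.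
  by rewrite (edge_coord_off aa nE sa) subrr normr0 mdist_ge0.
have [//|[a [a' [aa st]]]] := st_cover treeV t.
have it := edge_interiorP aa st nVt.
have : nbhs t (edge_interior a a').
  by apply: open_nbhs_nbhs; split=> //; exact: st_open treeV _ _ aa.
move=> /nbhs_ballP[r /= r0 rb]; exists r => // t' tt'.
have [st' _] : edge_interior a a' t' by apply: rb; rewrite ballEmdist.
have [E|nE] := pselect (is_edge a a').
  by apply: both; rewrite -(is_edge_segment E).
by rewrite (edge_coord_off aa nE st) (edge_coord_off aa nE st') subrr normr0 mdist_ge0.
Qed.

Lemma edge_coord_ivt x y (c : R) :
  Num.min (edge_coord x) (edge_coord y) <= c <= Num.max (edge_coord x) (edge_coord y) ->
  exists2 t, segment x y t & edge_coord t = c.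
Proof.
move=> cb; have [g gg] := st_geodesic treeV (x := x) (y := y) I I.
have [g0 gl _ gd] := gg.
have [||s sl sc] := @ivt_locally_lipschitz _ (edge_coord \o g) (mdist x y) c (mdist_ge0 x y).
- move=> s sl; have [r r0 rb] := edge_coord_local (g s); exists r => // s' s'l ss'.
  by rewrite -gd //; apply: rb; rewrite gd.
- by rewrite /= g0 gl.
- by exists (g s) => //; have [] := geodesic_segment gg sl.
Qed.

Lemma edge_coord_inner t : 0 < edge_coord t < 1 -> segment v w t.
Proof.
rewrite /edge_coord; case: asboolP => // _; case: asboolP => _; lra.
Qed.

(** The coordinate takes its intermediate values along a geodesic, and only one point
    of the tree has a given coordinate strictly between 0 and 1. *)
Lemma edge_cut x y p : segment v w p -> 0 < mdist v p < 1 ->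
  Num.min (edge_coord x) (edge_coord y) <= mdist v p <= Num.max (edge_coord x) (edge_coord y) ->
  segment x y p.
Proof.
move=> sp c01 cb; have [t st tc] := edge_coord_ivt cb.
have svt : segment v w t by apply: edge_coord_inner; rewrite tc.
by rewrite (edge_point_eq vw sp svt) // -tc edge_coord_edge.
Qed.

(** A geodesic through p runs along the edge near p, so it has coordinates on both
    sides of that of p; afterwards it cannot cross p a second time. *)
Lemma edge_cut_converse x z p : segment v w p -> 0 < mdist v p < 1 ->
  segment x z p ->
  Num.min (edge_coord x) (edge_coord z) <= mdist v p <= Num.max (edge_coord x) (edge_coord z).
Proof.
move=> sp c01 sxz; have hp := edge_coord_edge sp.
have [->|/eqP npx] := eqVneq x p; first by rewrite hp ge_min le_max !lexx.
have [->|/eqP npz] := eqVneq z p; first by rewrite hp ge_min le_max !lexx !orbT.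
have px0 : 0 < mdist p x by rewrite mdist_gt0; apply/eqP => e; apply: npx.
have pz0 : 0 < mdist p z by rewrite mdist_gt0; apply/eqP => e; apply: npz.
have nVp : ~ V p.
  by move=> Vp; have [e|e] := vertex_edge_end vw sp Vp; move: c01; rewrite e;
    [rewrite mdistxx|case: vw => _ _ ->]; lra.
have ip := edge_interiorP vw sp nVp.
have : nbhs p (edge_interior v w).
  by apply: open_nbhs_nbhs; split=> //; exact: st_open treeV _ _ vw.
move=> /nbhs_ballP[r /= r0 rb].
pose e := Num.min (r / 2) (Num.min (mdist p x) (mdist p z)).
have [e0 er ex ez] : [/\ 0 < e, e < r, e <= mdist p x & e <= mdist p z].
  rewrite /e !lt_min !ge_min !gt_min !lexx !orbT px0 pz0 /=; split=> //; lra.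
have [gx ggx] := st_geodesic treeV (x := p) (y := x) I I.
have [gz ggz] := st_geodesic treeV (x := p) (y := z) I I.
have [sx dx] := geodesic_segment ggx (s := e) ltac:(lra).
have [sz dz] := geodesic_segment ggz (s := e) ltac:(lra).
move: (gx e) (gz e) sx dx sz dz => x' z' sx dx sz dz.
have svx : segment v w x' by have [] : edge_interior v w x' by apply: rb; rewrite ballEmdist /= dx.
have svz : segment v w z' by have [] : edge_interior v w z' by apply: rb; rewrite ballEmdist /= dz.
have h1 := edge_dist vw sp svx; have h2 := edge_dist vw sp svz.
have h3 := edge_dist vw svx svz.
have hx' := edge_coord_edge svx; have hz' := edge_coord_edge svz.
have dxz : 2 * e <= mdist x' z'.
  move: sx sz sxz; rewrite /segment /= => sx sz sxz.
  have := metric_triangle x x' z; have := metric_triangle x' z' z.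
  have := metric_sym x x'; have := metric_sym x p; lra.
(* the coordinate cannot come back to that of p after leaving p *)
have stay q q' : segment p q q' -> 0 < mdist p q' ->
    ~ (Num.min (edge_coord q) (edge_coord q') <= mdist v p <= Num.max (edge_coord q) (edge_coord q')).
  move=> sq q0 /(edge_cut sp c01); move: sq; rewrite /segment /=.
  have := metric_sym q p; have := metric_sym q q'; lra.
have kx := stay _ _ sx ltac:(lra); have kz := stay _ _ sz ltac:(lra).
rewrite hx' in kx; rewrite hz' in kz.
move: h1 h2 h3; rewrite dx dz.
move: kx kz; rewrite !ge_min !le_max.
move: (edge_coord x) (edge_coord z) (mdist v p) (mdist v x') (mdist v z') => A B c X' Z'.
move: (mdist x' z') dxz => D dxz kx kz h1 h2 h3; clear -e0 dxz kx kz h1 h2 h3.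
have {}dxz : 2 * e <= `|X' - Z'| by rewrite -h3.
apply/andP; split; apply/negPn/negP; rewrite negb_or -!ltNge => /andP[cA cB].
  have cX : c < X' by rewrite ltNge; apply/negP => h; apply: kx; rewrite h (ltW cA) orbT.
  have cZ : c < Z' by rewrite ltNge; apply/negP => h; apply: kz; rewrite h (ltW cB) orbT.
  move: h1; rewrite distrC ger0_norm ?subr_ge0 ?(ltW cX) // => h1.
  move: h2; rewrite distrC ger0_norm ?subr_ge0 ?(ltW cZ) // => h2.
  by move: dxz; rewrite (_ : X' - Z' = 0) ?normr0; lra.
have cX : X' < c by rewrite ltNge; apply/negP => h; apply: kx; rewrite h (ltW cA) orbT.
have cZ : Z' < c by rewrite ltNge; apply/negP => h; apply: kz; rewrite h (ltW cB) orbT.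
move: h1; rewrite ger0_norm ?subr_ge0 ?(ltW cX) // => h1.
move: h2; rewrite ger0_norm ?subr_ge0 ?(ltW cZ) // => h2.
by move: dxz; rewrite (_ : X' - Z' = 0) ?normr0; lra.
Qed.

End edge.

Lemma tree_segment_slim_inner v w x y z p : adjacent V v w -> edge_interior v w p ->
  segment x z p -> segment x y p \/ segment y z p.
Proof.
move=> vw ip sxz; have [sp _] := ip.
have nVp := edge_interior_novertex vw ip.
have [Vv Vw vw1] := vw.
have c01 : 0 < mdist v p < 1.
  have pv : 0 < mdist v p by rewrite mdist_gt0; apply/eqP => e; apply: nVp; rewrite -e.
  have pw : 0 < mdist p w by rewrite mdist_gt0; apply/eqP => e; apply: nVp; rewrite e.
  by move: sp; rewrite /segment /= vw1; lra.
have := edge_cut_converse vw sp c01 sxz; rewrite ge_min le_max => /andP[h1 h2].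
have [hy|hy] := lerP (edge_coord v w y) (mdist v p).
  case/orP: h2 => h; [left|right]; apply: (edge_cut vw sp c01);
  by rewrite ge_min le_max h hy ?orbT.
case/orP: h1 => h; [left|right]; apply: (edge_cut vw sp c01);
by rewrite ge_min le_max h (ltW hy) ?orbT.
Qed.

(** 0-hyperbolicity. An inner point of an edge that separates x from z separates y
    from one of them; a vertex on a geodesic is a limit of such points. *)
Lemma tree_segment_slim x y z p : segment x z p -> segment x y p \/ segment y z p.
Proof.
move=> sxz; have [Vp|nVp] := pselect (V p); last first.
  have [//|[v [w [vw sp]]]] := st_cover treeV p.
  exact: tree_segment_slim_inner vw (edge_interiorP vw sp nVp) sxz.
have [->|/eqP npz] := eqVneq p z; first by right; exact: segment_r.
apply: contrapT => /not_orP[nxy nyz].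
have pz0 : 0 < mdist p z by rewrite mdist_gt0; apply/eqP.
clear npz.
have exy : mdist x y < mdist x p + mdist p y.
  by rewrite lt_neqAle metric_triangle andbT; apply/eqP => e; exact: nxy.
have eyz : mdist y z < mdist y p + mdist p z.
  by rewrite lt_neqAle metric_triangle andbT; apply/eqP => e; exact: nyz.
pose e := Num.min (Num.min (1 / 2) (mdist p z)) (Num.min ((mdist x p + mdist p y - mdist x y) / 4)
  ((mdist y p + mdist p z - mdist y z) / 4)).
have [e0 e1 ez e2 e3] : [/\ 0 < e, e <= 1 / 2, e <= mdist p z,
  e <= (mdist x p + mdist p y - mdist x y) / 4 & e <= (mdist y p + mdist p z - mdist y z) / 4].
  by rewrite /e !lt_min !ge_min !lexx !orbT pz0; split=> //; lra.
have [g gg] := st_geodesic treeV (x := p) (y := z) I I.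
have [sg dg] := geodesic_segment gg (s := e) ltac:(lra).
move: (g e) sg dg => q sg dg.
have nVq : ~ V q.
  move=> Vq; have [pq|/eqP npq] := eqVneq p q; first by move: dg; rewrite -pq mdistxx; lra.
  have := st_separated treeV Vp Vq npq; clear npq; lra.
have sxq : segment x z q.
  apply: segment_sym; have [] := segment_trans (segment_sym sxz) (segment_sym sg) => //.
have [//|[v [w [vw sq]]]] := st_cover treeV q.
have iq := edge_interiorP vw sq nVq.
have := metric_sym p q; have := metric_triangle x q p; have := metric_triangle p q y.
have := metric_triangle y q p; have := metric_triangle p q z.
case: (tree_segment_slim_inner y vw iq sxq); rewrite /segment /= => h *; lra.
Qed.

Lemma vertex_next w u : V w -> V u -> w <> u ->
  exists w', [/\ adjacent V w w', segment w u w' & mdist w u = 1 + mdist w' u].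
Proof.
move=> Vw Vu wu; have wu1 := st_separated treeV Vw Vu wu; clear wu.
have [g gg] := st_geodesic treeV (x := w) (y := u) I I.
have [sg dg] := geodesic_segment gg (s := 1 / 3) ltac:(lra).
move: (g (1 / 3)) sg dg => p sp dp.
have [pw|[w' ww' sp']] := star_ball Vw (t' := p) ltac:(lra).
  by exfalso; move: dp; rewrite pw mdistxx; lra.
have hp := edge_coord_edge sp'.
have := edge_cut_converse ww' sp' ltac:(lra) sp.
have nw := near_side_v w w'.
rewrite (edge_coord_vertex ww' Vw) (edge_coord_vertex ww' Vu) asboolT //.
case: asboolP => nu; rewrite ?minxx ?maxxx; first by rewrite dp; lra.
move=> _; exists w'.
have d1 : mdist w' u + 1 <= mdist w u.
  apply/ler_addgt0Pr => e e0; pose f := Num.min (1 / 3) (e / 2).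
  have [f0 f1 fe] : [/\ 0 < f, f <= 1 / 3 & f <= e / 2].
    by rewrite /f lt_min !ge_min !lexx orbT; split=> //; lra.
  have [q sq dq] := edge_at ww' (s := 1 - f) ltac:(lra).
  have := edge_cut (x := w) (y := u) ww' sq ltac:(lra).
  rewrite (edge_coord_vertex ww' Vw) (edge_coord_vertex ww' Vu) asboolT // asboolF //.
  rewrite min_l // max_r // dq => /(_ ltac:(lra)).
  case: ww' => _ _ ww1; move: sq; rewrite /segment /= ww1 dq => sq h.
  by have := metric_triangle w' q u; have := metric_sym w' q; lra.
have [_ _ ww1] := ww'; have := metric_triangle w w' u; rewrite ww1 => d2.
by split=> //; rewrite /segment /= ?ww1; lra.
Qed.

Lemma vertex_dist_nat w u : V w -> V u -> exists n : nat, mdist w u = n%:R.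
Proof.
move=> Vw Vu; have [n un] : exists n : nat, mdist w u < n%:R.
  exists (Num.truncn (mdist w u)).+1.
  by have /andP[] := truncn_itv (mdist_ge0 w u).
elim: n w Vw un => [|n IHn] w Vw un; first by have := mdist_ge0 w u; lra.
have [->|/eqP wu] := eqVneq w u; first by exists 0%N; rewrite mdistxx.
have [w' [[_ Vw' _] _ dw]] := vertex_next Vw Vu wu; clear wu.
have [|m dm] := IHn w' Vw'; first by move: un; rewrite -natr1; lra.
by exists m.+1; rewrite dw dm -natr1 addrC.
Qed.

(** The median is the point of [u, v] whose distance to u is the Gromov product. It is
    a vertex: an inner point of an edge has only two sides, so it cannot separate
    three points pairwise. *)
Lemma vertex_median u v s : V u -> V v -> V s ->
  exists b, [/\ V b, segment u v b, segment u s b & segment v s b].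
Proof.
move=> Vu Vv Vs.
pose c := (mdist u v + mdist u s - mdist v s) / 2.
have cb : 0 <= c <= mdist u v.
  have := metric_triangle v u s; have := metric_triangle u v s.
  by have := metric_sym u v; rewrite /c; lra.
have [g gg] := st_geodesic treeV (x := u) (y := v) I I.
have [sg dg] := geodesic_segment gg cb.
move: (g c) sg dg => b sb db.
have [sus svs] : segment u s b /\ segment v s b.
  have := metric_sym b v; have := metric_sym s b.
  have := metric_sym s v; move: sb (sb).
  move=> /(tree_segment_slim s)[]; move: db; rewrite /segment /= /c; split; lra.
exists b; split=> //; apply: contrapT => nVb.
have [//|[a [a' [aa sa]]]] := st_cover treeV b.
have [Va Va' a1] := aa.
have c01 : 0 < mdist a b < 1.
  have pv : 0 < mdist a b by rewrite mdist_gt0; apply/eqP => e; apply: nVb; rewrite -e.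
  have pw : 0 < mdist b a' by rewrite mdist_gt0; apply/eqP => e; apply: nVb; rewrite e.
  by move: sa; rewrite /segment /= a1; lra.
have := edge_cut_converse aa sa c01 sb; have := edge_cut_converse aa sa c01 sus.
have := edge_cut_converse aa sa c01 svs.
rewrite !(edge_coord_vertex aa) //.
do 3 (case: asboolP => _); rewrite ?minxx ?maxxx; lra.
Qed.

Lemma edge_coord_continuous v w : adjacent V v w -> continuous (edge_coord v w).
Proof.
move=> vw t; apply/cvgrPdist_lt => e e0.
have [r r0 rb] := edge_coord_local vw t.
apply/nbhs_ballP; exists (Num.min r e); first by rewrite /= lt_min r0 e0.
move=> t'; rewrite ballEmdist /= lt_min => /andP[tr te].
exact: le_lt_trans (rb t' tr) te.
Qed.

Lemma connected_crosses_edge v w (S : set T) p : adjacent V v w -> connected S ->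
  S v -> segment v w p -> 0 < mdist v p < 1 ->
  (exists2 t, S t & mdist v p <= edge_coord v w t) -> S p.
Proof.
move=> vw cS Sv sp c01 [t St ht].
have cE : connected (edge_coord v w @` S).
  apply: connected_continuous_connected => //; apply: continuous_subspaceT.
  exact: edge_coord_continuous.
move/connected_intervalP: cE => iE.
have [|||q Sq qp] := iE (edge_coord v w v) (edge_coord v w t) _ _ (mdist v p).
- by exists v.
- by exists t.
- rewrite edge_coord_edge; last exact: segment_l.
  by rewrite mdistxx ht; lra.
suff <- : q = p by [].
have sq : segment v w q by apply: edge_coord_inner; rewrite qp.
by apply: (edge_point_eq vw sq sp); rewrite -(edge_coord_edge sq).
Qed.

Lemma segment_star_connected v (S : set T) :
  S v -> (forall t q, S t -> segment v t q -> S q) -> connected S.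
Proof.
move=> Sv star.
have [G HG] := choice (fun t => st_geodesic treeV (x := v) (y := t) I I).
have -> : S = \bigcup_(t in S) side mdist v t (G t).
  apply/seteqP; split=> [t St|q [t St [s sl <-]]].
    exists t => //; exists (mdist v t) => /=; first by rewrite mdist_ge0 lexx.
    by case: (HG t).
  by apply: star St _; case: (geodesic_segment (HG t) sl).
apply: bigcup_connected.
  exists v => t St; exists 0 => /=; first by rewrite mdist_ge0 lexx.
  by case: (HG t).
move=> t St; rewrite /side (_ : [set s | _] = `[0, mdist v t]%classic); last first.
  by apply/seteqP; split=> s /=; rewrite in_itv.
apply: connected_continuous_connected; first exact: segment_connected.
apply/subspace_continuousP => s /=; rewrite in_itv /= => sl.
have [_ _ _ gd] := HG t.
move=> A /nbhs_ballP[r /= r0 rA]; apply/nbhs_ballP; exists r => // s' ss'.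
rewrite /= in_itv /= => s'l; apply: rA.
by rewrite ballEmdist /= gd.
Qed.

Lemma halftree_closed v w t q : segment w t v -> segment v t q -> segment w q v.
Proof.
rewrite /segment /= => h1 h2; have := metric_triangle w q t.
by have := metric_triangle w v q; lra.
Qed.

(** A larger subtree would contain a point beyond v, and being connected it would
    contain inner points of the edge, hence the whole edge. *)
Lemma halftree_maximal v w : adjacent V v w ->
  max_subtree_avoiding V v w [set t | segment w t v].
Proof.
move=> vw; have [Vv Vw vw1] := vw; have wv := adjacent_sym vw.
split.
  split; [split| exact: segment_r |].
  - by exists v; exact: segment_r.
  - apply: (@segment_star_connected v); first exact: segment_r.
    by move=> t q /= h1 h2; exact: halftree_closed h1 h2.
  - move=> t /= swt; have [Vt|nVt] := pselect (V t); [by left|right].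
    have [//|[a [a' [aa sa]]]] := st_cover treeV t.
    have main b b' : adjacent V b b' -> segment b b' t -> segment w b' t ->
        forall q, segment b b' q -> segment w q v.
      move=> bb sb swb q sq; have [Vb Vb' _] := bb.
      have swb' : segment w b' v by have [] := segment_trans swb swt.
      have swb0 : segment w b v.
        have [//|h] := tree_segment_slim b swt.
        have [h' _] := segment_trans sb h.
        have [e|e] := vertex_edge_end bb h' Vv.
          by rewrite e; exact: segment_r.
        by exfalso; apply: nVt; rewrite e in h; rewrite -(segment_anti sb h).
      have [//|h1] := tree_segment_slim q swb0.
      have [//|h2] := tree_segment_slim q swb'.
      have [h3 _] := segment_trans sq (segment_sym h1).
      have [e|e] := vertex_edge_end bb h3 Vv.
        rewrite e in h2; rewrite -(segment_anti (segment_sym sq) (segment_sym h2)) e.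
        exact: segment_r.
      rewrite e in h1; rewrite -(segment_anti sq (segment_sym h1)) e.
      exact: segment_r.
    have [h|h] := tree_segment_slim w sa.
      exists a', a; split; [exact: adjacent_sym|exact: segment_sym|].
      move=> q sq; apply: (main a' a) sq; [exact: adjacent_sym|exact: segment_sym|].
      exact: segment_sym.
    exists a, a'; split=> // q sq; apply: (main a a') sq => //; exact: segment_sym.
  - move=> /(_ w (segment_l w v)) /= h; apply: (vertex_adjacent_neq vw).
    exact: segment_eq h.
move=> S' [[S'0 cS' S'e] S'v nS'] SS'; apply/seteqP; split=> // t S't.
apply: contrapT => nt; apply: nS'.
have sE : segment w v = segment v w by apply/seteqP; split=> q; exact: segment_sym.
have inner q : segment v w q -> ~ V q -> S' q -> segment w v `<=` S'.
  move=> sq nVq S'q; have [//|[a [a' [aa sa sS]]]] := S'e q S'q.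
  have iq := edge_interiorP vw sq nVq; have iq' := edge_interiorP aa sa nVq.
  rewrite sE; have [[-> ->] //|[-> ->]] := st_disjoint treeV vw aa iq iq'.
  by move=> x /segment_sym; exact: sS.
have [swt|nswt] := pselect (segment v w t).
  have [Vt|nVt] := pselect (V t); last exact: inner swt nVt S't.
  have [e|e] := vertex_edge_end vw swt Vt.
    by exfalso; apply: nt; rewrite e; exact: segment_r.
  have [p sp dp] := edge_at vw (s := 1 / 2) ltac:(lra).
  have S'p : S' p.
    apply: (connected_crosses_edge vw) => //; rewrite dp; first by lra.
    exists t => //; rewrite e edge_coord_edge; last exact: segment_r.
    by rewrite vw1; lra.
  apply: inner S'p => // Vp; have [e'|e'] := vertex_edge_end vw sp Vp.
    by move: dp; rewrite e' mdistxx; lra.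
  by move: dp; rewrite e' vw1; lra.
have h1 : edge_coord v w t = 1.
  have : edge_coord v w t = 1 \/ edge_coord v w t = 0.
    by rewrite /edge_coord asboolF //; case: asboolP; [left|right].
  case=> // h0; exfalso; apply: nt => /=.
  suff : mdist v t + 1 <= mdist w t.
    rewrite /segment /= (metric_sym w v) vw1.
    by have := metric_triangle w v t; rewrite (metric_sym w v) vw1; lra.
  apply/ler_addgt0Pr => e e0; pose f := Num.min (1 / 3) (e / 2).
  have [f0 f1 fe] : [/\ 0 < f, f <= 1 / 3 & f <= e / 2].
    by rewrite /f lt_min !ge_min !lexx orbT; split=> //; lra.
  have [q sq dq] := edge_at vw (s := f) ltac:(lra).
  have := edge_cut (x := t) (y := w) vw sq ltac:(lra).
  rewrite h0 edge_coord_edge ?vw1; last exact: segment_r.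
  rewrite min_l // max_r // dq => /(_ ltac:(lra)).
  move: sq; rewrite /segment /= vw1 dq => sq h.
  have := metric_triangle v q t; have := metric_sym t q; have := metric_sym t w.
  by lra.
have [p sp dp] := edge_at vw (s := 1 / 2) ltac:(lra).
have S'p : S' p.
  apply: (connected_crosses_edge vw) => //; rewrite dp; first by lra.
  by exists t => //; rewrite h1; lra.
apply: inner S'p => // Vp; have [e'|e'] := vertex_edge_end vw sp Vp.
  by move: dp; rewrite e' mdistxx; lra.
by move: dp; rewrite e' vw1; lra.
Qed.

(** The distance to b, counted negatively as long as b is not between pi x and the
    moving point, is continuous along the image of a geodesic. *)
Lemma geodesic_crosses (X : metricType R) (pi : X -> T) (x y : X) b :
  geodesic_space [set: X] mdist -> (forall x y : X, mdist (pi x) (pi y) <= mdist x y) ->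
  segment (pi x) (pi y) b -> exists2 z, pi z = b & segment x y z.
Proof.
move=> gX lip sb; have [g gg] := gX x y I I.
have [g0 gl _ gd] := gg.
pose k (s : R) := if `[< segment (pi x) (pi (g s)) b >] then mdist (pi (g s)) b
            else - mdist (pi (g s)) b.
have step (s t : R) : 0 <= s <= mdist x y -> 0 <= t <= mdist x y ->
    segment (pi x) (pi (g s)) b -> ~ segment (pi x) (pi (g t)) b ->
    mdist (pi (g s)) b + mdist (pi (g t)) b <= `|s - t|.
  move=> sl tl h1 h2; rewrite -gd //; apply: le_trans (lip _ _).
  have [//|] := tree_segment_slim (pi (g t)) h1.
  rewrite /segment /= (metric_sym (pi (g t)) (pi (g s))).
  by have := metric_sym b (pi (g s)); lra.
have same (s t : R) : 0 <= s <= mdist x y -> 0 <= t <= mdist x y ->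
    `|mdist (pi (g s)) b - mdist (pi (g t)) b| <= `|s - t|.
  move=> sl tl; rewrite -(gd s t) //; have := lip (g s) (g t).
  have := metric_triangle (pi (g s)) (pi (g t)) b.
  have := metric_triangle (pi (g t)) (pi (g s)) b.
  have := metric_sym (pi (g t)) (pi (g s)).
  by rewrite ler_norml; lra.
have klip (s t : R) : 0 <= s <= mdist x y -> 0 <= t <= mdist x y -> `|k s - k t| <= `|s - t|.
  move=> sl tl; have := same s t sl tl; rewrite /k.
  case: asboolP => hs; case: asboolP => ht => h //.
  - by rewrite opprK ger0_norm ?addr_ge0 ?mdist_ge0 //; exact: step.
  - rewrite -opprD normrN ger0_norm ?addr_ge0 ?mdist_ge0 // addrC distrC.
    by apply: step.
  - by rewrite opprK addrC distrC.
have [||s sl ks] := @ivt_locally_lipschitz _ k (mdist x y) 0 (mdist_ge0 x y).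
- by move=> s sl; exists 1 => // s' s'l _; exact: klip.
- rewrite /k g0 gl (asboolT sb) ge_min le_max mdist_ge0 orbT andbT.
  case: asboolP => h; rewrite ?oppr_le0 ?mdist_ge0 //.
  by rewrite (segment_eq h) mdistxx lexx.
exists (g s); last by have [] := geodesic_segment gg sl.
by apply: mdist_positivity; move: ks; rewrite /k; case: asboolP => _; lra.
Qed.

End tree.

Section chains.
Context {R : realType} {X : metricType R}.
Implicit Types (N : set X) (x y z : X).

(** A path with unit steps cannot jump between two balls that are far apart. *)
Lemma two_clusters (E : R) n (c : nat -> X) x y : 0 <= E ->
  (forall i, (i <= n)%N -> mdist (c i) x <= E \/ mdist (c i) y <= E) ->
  (forall i, mdist (c i) (c i.+1) <= 1) -> mdist (c 0%N) (c n) <= 4 * E + 1.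
Proof.
move=> E0; wlog c0 : x y / mdist (c 0%N) x <= E => [hw|] cl st.
  have [h|h] := cl 0%N isT; first exact: (hw x y).
  by apply: (hw y x) => // i /cl[]; [right|left].
have t1 := metric_triangle (c 0%N) x (c n).
have [all|[i [iln Pi nP]]] := first_failure (P := fun i => mdist (c i) x <= E) n c0.
  by have := all n (leqnn n); have := metric_sym x (c n); lra.
have [//|ci] := cl i.+1 iln.
have xy : mdist x y <= 2 * E + 1.
  have := metric_triangle x (c i) y; have := metric_triangle (c i) (c i.+1) y.
  by have := metric_sym x (c i); have := st i; lra.
have := metric_triangle x y (c n); have := metric_sym x (c n); have := metric_sym y (c n).
by case: (cl n (leqnn n)) => h; lra.
Qed.

Definition reach (sigma : R) N (n : nat) x y : Prop := exists a : nat -> X,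
  [/\ a 0%N = x, a n = y, forall i, (i <= n)%N -> N (a i)
    & forall i, (i < n)%N -> mdist (a i) (a i.+1) <= sigma].

Lemma reach_cat sigma N n m x y z : reach sigma N n x y -> reach sigma N m y z ->
  reach sigma N (n + m) x z.
Proof.
move=> [a [a0 an aN ast]] [b [b0 bm bN bst]].
exists (fun k => if (k <= n)%N then a k else b (k - n)%N); split.
- by rewrite leq0n.
- case: leqP => h; last by rewrite addKn.
  have m0 : m = 0%N by clear -h; lia.
  by rewrite m0 addn0 an -bm m0 b0.
- by move=> i im; case: leqP => h; [exact: aN|apply: bN; clear -im; lia].
- move=> i im; case: (ltngtP i n) => h.
  + exact: ast.
  + rewrite subSn; last exact: ltnW.
    by apply: bst; clear -im h; lia.
  + rewrite h subSn // subnn an -b0.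
    by apply: bst; clear -im h; lia.
Qed.

Lemma reach_sub sigma N n (a : nat -> X) i j : (i <= j <= n)%N ->
  (forall k, (k <= n)%N -> N (a k)) ->
  (forall k, (k < n)%N -> mdist (a k) (a k.+1) <= sigma) ->
  reach sigma N (j - i) (a i) (a j).
Proof.
move=> /andP[ij jn] aN ast; exists (fun k => a (i + k)%N); split.
- by rewrite addn0.
- by rewrite subnKC.
- by move=> k kl; apply: aN; clear -kl ij jn; lia.
- by move=> k kl; rewrite addnS; apply: ast; clear -kl ij jn; lia.
Qed.

Lemma reach_sym sigma N n x y : reach sigma N n x y -> reach sigma N n y x.
Proof.
move=> [a [a0 an aN ast]]; exists (fun i => a (n - i)%N); split.
- by rewrite subn0.
- by rewrite subnn.
- by move=> i _; apply: aN; exact: leq_subr.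
- move=> i iln; rewrite metric_sym subnS -[X in mdist _ (a X)](@prednK (n - i)%N) ?subn_gt0 //.
  by apply: ast; clear -iln; lia.
Qed.

Lemma reachW sigma sigma' N N' n x y : sigma <= sigma' -> N `<=` N' ->
  reach sigma N n x y -> reach sigma' N' n x y.
Proof.
move=> ss NN [a [a0 an aN ast]]; exists a; split=> // i iln; first exact/NN/aN.
exact: le_trans (ast i iln) ss.
Qed.

(** A path with the least number of steps is quasi-geodesic, since each of its parts
    has the least number of steps too. *)
Lemma shortest_quasi_path sigma K N : 0 <= K ->
  (forall x y, N x -> N y -> exists2 n, reach sigma N n x y & n%:R <= K * mdist x y + K) ->
  forall x y, N x -> N y ->
  exists n a, [/\ a 0%N = x, a n = y & quasi_path sigma K N n a].
Proof.
move=> K0 rN x y Nx Ny; have [n0 rn0 _] := rN x y Nx Ny.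
have ex : exists n, `[< reach sigma N n x y >] by exists n0; apply/asboolP.
case: (ex_minnP ex) => n /asboolP rn nmin; have [a [a0 an aN ast]] := rn.
exists n, a; split=> //; split=> // i j ij; have /andP[ij1 jn] := ij.
have Ni : N (a i) by apply: aN; clear -ij1 jn; lia.
have [m rm mK] := rN _ _ Ni (aN j jn).
apply: le_trans mK; rewrite -natrB // ler_nat.
have r1 := reach_sub (i := 0%N) (j := i) _ aN ast.
have r2 := reach_sub (i := j) (j := n) _ aN ast.
have := nmin (i + m + (n - j))%N.
rewrite asboolT; first by move=> /(_ isT); clear -ij1 jn; lia.
rewrite -a0 -an; apply: reach_cat; last by apply: r2; rewrite jn leqnn.
apply: reach_cat rm.
by have := r1 ltac:(clear -ij1 jn; lia); rewrite subn0.
Qed.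

Lemma geodesic_chain x y : geodesic_space [set: X] mdist ->
  exists n (c : nat -> X), [/\ c 0%N = x, c n = y, n%:R <= mdist x y + 1
    & forall i, mdist (c i) (c i.+1) <= 1].
Proof.
move=> gX; have [g [g0 gl _ gd]] := gX x y I I.
have l0 := mdist_ge0 x y.
have minb (i : nat) : 0 <= Num.min i%:R (mdist x y) <= mdist x y.
  by rewrite ge_min lexx orbT andbT le_min l0 ler0n.
have /andP[t1 t2] := truncn_bounds l0.
exists (Num.truncn (mdist x y)).+1, (fun i => g (Num.min i%:R (mdist x y))); split.
- by rewrite min_l.
- by rewrite min_r // -natr1 ltW.
- by rewrite -natr1; lra.
- move=> i; rewrite gd // -natr1 ler_norml.
  by rewrite !minElt; do 2 case: ltP => ?; lra.
Qed.

End chains.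

(** * Pieces and their projections *)

(** Throughout, N w is a neighbourhood of M w, and M_beyond says that M w is contained
    in M b beyond a vertex b. *)
Section tree_of_pieces.
Context {R : realType} {X T : metricType R}.
Variables (V : set T) (pi : X -> T) (M N : T -> set X) (rho : T -> X -> X).
Variables (L' C L1 delta : R) (eta : R -> R).
Hypotheses (L'0 : 0 <= L') (C0 : 0 <= C) (L10 : 0 <= L1) (delta0 : 0 <= delta).
Hypothesis eta0 : forall r : R, 0 <= r -> 0 <= eta r.
Hypothesis treeV : simplicial_tree V.
Hypothesis gX : geodesic_space [set: X] mdist.
Hypothesis lip : forall x y : X, mdist (pi x) (pi y) <= mdist x y.
Hypothesis surj : forall t, exists x, pi x = t.
Hypothesis XM : forall x, V (pi x) -> M (pi x) x.
Hypothesis MN : forall u, V u -> M u `<=` N u.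
Hypothesis NM : forall u x, V u -> N u x -> near_set L1 (M u) x.
Hypothesis M_beyond : forall u b m, V u -> V b -> M u m -> segment u (pi m) b -> M b m.
Hypothesis retr : forall u, V u -> coarse_retraction L' (M u) (rho u).

(** The condition on all vertices between w and v makes the relation inherited by
    subintervals, which need not hold if only the ends are considered. *)
Definition arrow w v := forall b, V b -> segment w v b -> exists2 m, M w m & pi m = b.
Definition linked w v := [/\ V w, V v & arrow w v \/ arrow v w].

Hypothesis piece_N : forall u, V u -> piece delta eta (N u).
Hypothesis piece_linked : forall u v, linked u v -> piece delta eta (N u `|` N v).

Implicit Types (u v w b t : T) (x y z p q o m : X) (A : set X).

Let vertex_point u : V u -> exists x, [/\ pi x = u, M u x & N u x].
Proof.
move=> Vu; have [x xu] := surj u; have Mx : M u x by have := @XM x; rewrite xu; apply.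
by exists x; split=> //; exact: MN.
Qed.

Lemma linked_sym w v : linked w v -> linked v w.
Proof. by move=> [Vw Vv [h|h]]; split=> //; [right|left]. Qed.

Lemma linked_refl w : V w -> linked w w.
Proof.
move=> Vw; split=> //; left=> b Vb /segment_eq ->.
by have [x [xw Mx _]] := vertex_point Vw; exists x.
Qed.

Lemma arrow_sub w t b : V w -> V b -> arrow w t -> segment w t b ->
  arrow w b /\ arrow b t.
Proof.
move=> Vw Vb wt sb; split=> c Vc sc.
  by apply: wt => //; have [] := segment_trans sb sc.
have [h1 h2] := segment_trans (segment_sym sb) (segment_sym sc).
have [m Mm mc] := wt c Vc (segment_sym h1).
by exists m => //; apply: (M_beyond Vw Vb Mm); rewrite mc; exact: segment_sym.
Qed.

Lemma linked_sub w t b : linked w t -> V b -> segment w t b -> linked w b /\ linked b t.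
Proof.
move=> [Vw Vt [h|h]] Vb sb.
  by have [h1 h2] := arrow_sub Vw Vb h sb; split; split=> //; left.
have [h1 h2] := arrow_sub Vt Vb h (segment_sym sb).
by split; split=> //; right.
Qed.

Lemma linked_common w t : linked w t -> exists2 m, N w m & N t m.
Proof.
suff main w' t' : V w' -> V t' -> arrow w' t' -> exists2 m, N w' m & N t' m.
  move=> [Vw Vt [h|h]]; first exact: main.
  by have [m m1 m2] := main _ _ Vt Vw h; exists m.
move=> Vw Vt h; have [m Mm mt] := h t' Vt (segment_r w' t').
exists m; first exact: MN.
by apply: MN => //; have := @XM m; rewrite mt; apply.
Qed.

(** If p is close to m in M w and to m' in M t, then m or m' lies beyond b, hence in
    M b, or b separates them and a short geodesic between them crosses the fibre. *)
Lemma coarse_between r w t b p : V w -> V t -> V b -> segment w t b ->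
  near_set r (M w) p -> near_set r (M t) p -> near_set (3 * r) (M b) p.
Proof.
move=> Vw Vt Vb sb [m Mm pm] [m' Mm' pm'].
have r0 : 0 <= r by have := mdist_ge0 p m; lra.
have [h|h1] := tree_segment_slim treeV (pi m) sb.
  by exists m; [exact: (M_beyond Vw)|lra].
have [h|h2] := tree_segment_slim treeV (pi m') (segment_sym h1).
  by exists m'; [exact: (M_beyond Vt)|lra].
have [z zb sz] := geodesic_crosses treeV gX lip (segment_sym h2).
exists z; first by have := @XM z; rewrite zb; apply.
move: sz; rewrite /segment /= => sz; have := metric_triangle p m z.
have := metric_triangle m p m'; have := metric_sym m p; have := mdist_ge0 z m'; lra.
Qed.

(* bounds the steps of a path in N w obtained by retracting a geodesic of X *)
Let sigma := 2 * L' + L1 + L' * L1 + L'.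
Let sigma0 : 0 <= sigma.
Proof.
have := L'0; have := L10 => h1 h2; have := mulr_ge0 h2 h1; rewrite /sigma; lra.
Qed.

Lemma N_reach w : V w -> forall x y, N w x -> N w y ->
  exists2 n, reach sigma (N w) n x y & n%:R <= 3 * mdist x y + 3.
Proof.
move=> Vw x y Nx Ny; have [rM rL rid] := retr Vw.
have [h1 h2] := (L'0, L10); have h3 := mulr_ge0 h1 h2.
have ends z : N w z -> mdist z (rho w z) <= sigma.
  move=> /(NM Vw)[m Mm zm]; have := rL m z; rewrite rid //.
  have := metric_triangle z m (rho w z); rewrite (metric_sym m z).
  have : L' * mdist z m <= L' * L1 by rewrite ler_wpM2l.
  by rewrite /sigma; lra.
have one z z' : N w z -> N w z' -> mdist z z' <= sigma -> reach sigma (N w) 1 z z'.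
  move=> Nz Nz' zz; exists (fun i => if i is 0%N then z else z'); split=> //.
  - by move=> [|[]].
  - by move=> [|].
have [n [c [c0 cn nl cst]]] := geodesic_chain x y gX.
exists (1 + n + 1)%N; last by rewrite !natrD; have := mdist_ge0 x y; lra.
apply: (reach_cat (y := rho w y)); last first.
  by apply: one => //; [exact: MN|rewrite metric_sym; exact: ends].
apply: (reach_cat (y := rho w x)).
  by apply: one => //; [exact: MN|exact: ends].
exists (fun i => rho w (c i)); split; rewrite ?c0 ?cn //.
- by move=> i _; exact: MN.
- move=> i _; apply: le_trans (rL _ _) _.
  have : L' * mdist (c i) (c i.+1) <= L' * 1 by rewrite ler_wpM2l.
  by rewrite /sigma; lra.
Qed.

(** All pieces containing N w have the same geodesics between points of N w, up to
    a bounded error: both families are compared with shortest chains in N w. *)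
Lemma seg_pieces_close : exists2 D, 0 <= D & forall w A A' x y p, V w ->
  piece delta eta A -> piece delta eta A' -> N w `<=` A -> N w `<=` A' ->
  N w x -> N w y -> seg A x y p -> near_set D (seg A' x y) p.
Proof.
have es := eta0 sigma0; have d0 := delta0.
have [||D D0 stab] := @coarse_paths_stability R X sigma (1 + delta + eta sigma) 3 sigma0.
- by lra.
- by lra.
exists (D + D); first lra.
move=> w A A' x y p Vw pA pA' NA NA' Nx Ny linked.
have [n [a [a0 an qa]]] := shortest_quasi_path (K := 3) ltac:(lra) (N_reach Vw) Nx Ny.
have [s1 _] := stab _ _ (piece_coarse_paths delta0 eta0 pA sigma0 NA) n a qa.
have [_ s2] := stab _ _ (piece_coarse_paths delta0 eta0 pA' sigma0 NA') n a qa.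
rewrite a0 an in s1 s2; have [i iln pi'] := s1 p linked.
exact: near_set_dist pi' (s2 i iln).
Qed.

Lemma seg_change (r : R) : 0 <= r -> exists2 D, 0 <= D & forall w A A' x y x' y' p,
  V w -> piece delta eta A -> piece delta eta A' -> N w `<=` A -> N w `<=` A' ->
  A x -> A y -> A' x' -> A' y' -> near_set r (N w) x -> near_set r (N w) y ->
  mdist x x' <= r -> mdist y y' <= r -> seg A x y p -> near_set D (seg A' x' y') p.
Proof.
move=> r0; have [D D0 close] := seg_pieces_close.
have e1 := eta0 r0; have e2 : 0 <= eta (2 * r) by apply: eta0; lra.
have d0 := delta0.
exists ((2 * delta + eta r + r) + (D + (2 * delta + eta (2 * r) + 2 * r))); first lra.
move=> w A A' x y x' y' p Vw pA pA' NA NA' Ax Ay Ax' Ay' [x1 Nx1 xx1] [y1 Ny1 yy1] xx yy pxy.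
have h1 := seg_near_ends delta0 eta0 pA Ax Ay (NA _ Nx1) (NA _ Ny1) r0 xx1 yy1 pxy.
apply: near_set_trans h1 _ => q /(close w A A' _ _ _ Vw pA pA' NA NA' Nx1 Ny1) h2.
apply: near_set_trans h2 _ => q' h3; apply: (seg_near_ends delta0 eta0 pA') h3 => //.
- exact: NA'.
- exact: NA'.
- lra.
- have := metric_triangle x1 x x'; rewrite (metric_sym x1 x); lra.
- have := metric_triangle y1 y y'; rewrite (metric_sym y1 y); lra.
Qed.

Lemma seg_quasiconvex (r : R) : 0 <= r -> exists2 D, 0 <= D & forall w A x y p, V w ->
  piece delta eta A -> N w `<=` A -> A x -> A y -> near_set r (N w) x ->
  near_set r (N w) y -> seg A x y p -> near_set D (N w) p.
Proof.
move=> r0; have [D D0 DP] := seg_change r0; exists D => //.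
move=> w A x y p Vw pA NA Ax Ay [x' Nx xx] [y' Ny yy] linked.
have [q sq pq] := DP w A (N w) x y x' y' p Vw pA (piece_N Vw) NA (fun _ h => h) Ax Ay
  Nx Ny (ex_intro2 _ _ x' Nx xx) (ex_intro2 _ _ y' Ny yy) xx yy linked.
by exists q => //; exact: seg_in sq.
Qed.

(** The nearest point projection of z to N w, expressed by geodesics only: all geodesics
    of A from z to points of N w pass near p. *)
Definition gate (D : R) A w z p : Prop :=
  N w p /\ forall m, N w m -> near_set D (seg A z m) p.

(** The gate is the first point of some geodesic from z to N w that comes close to N w;
    a slim triangle shows that the other geodesics from z to N w follow it until then. *)
Lemma gate_exists : exists2 D, 0 <= D & forall w A z, V w -> piece delta eta A ->
  N w `<=` A -> A z -> exists p, gate D A w z p.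
Proof.
have [k k0 kP] := @seg_quasiconvex 0 (lexx 0); have d0 := delta0.
exists (k + delta + 2 + delta); first lra.
move=> w A z Vw pA NA Az; have [m0 [_ _ Nm0]] := vertex_point Vw.
have [n [c [c0 cn cs cst]]] := seg_connected pA Az (NA _ Nm0).
pose P i := `[< near_set (k + delta + 1) (N w) (c i) >].
have ex : exists i, P i.
  by exists n; apply/asboolP; rewrite cn; apply: near_set0 => //; lra.
case: (ex_minnP ex) => -[|i] /asboolP[p Np cp] imin; exists p; split=> // m Nm.
  exists z; first by apply: (seg_l pA) => //; exact: NA.
  by rewrite metric_sym -c0; lra.
have nP : ~ near_set (k + delta + 1) (N w) (c i).
  by move=> h; have := imin i; rewrite ltnn => /(_ ltac:(by apply/asboolP)).
have pc : mdist p (c i) <= k + delta + 2.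
  have := metric_triangle p (c i.+1) (c i); have := metric_sym p (c i.+1).
  have := metric_sym (c i.+1) (c i); have := cst i; lra.
have [h|h] := near_setU (seg_slim pA Az (NA _ Nm0) (NA _ Nm) (cs i)).
  exact: near_set_dist pc h.
exfalso; apply: nP; have near0 q : N w q -> near_set 0 (N w) q.
  by move=> Nq; apply: near_set0.
have h' : near_set (delta + k) (N w) (c i).
  apply: near_set_trans h _ => q sq.
  by apply: (kP w A m m0) sq => //; [exact: NA|exact: NA|exact: near0|exact: near0].
by apply: near_setW h' => //; lra.
Qed.

(** A geodesic from z to its gate stays away from N w until it is close to the gate. *)
Lemma gate_unique (D r : R) : 0 <= D -> 0 <= r -> exists2 D', 0 <= D' &
  forall w A z p o q, piece delta eta A -> N w `<=` A -> A z ->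
  gate D A w z p -> seg A z p o -> N w q -> mdist q o <= r -> mdist q p <= D'.
Proof.
move=> D0 r0; pose D2 := D + (2 * delta + eta r + r).
have d0 := delta0; have er := eta0 r0; have e0 : 0 <= eta 0 by exact: eta0.
have D20 : 0 <= D2 by rewrite /D2; lra.
have eD : 0 <= eta (D2 + delta) by apply: eta0; lra.
exists (r + (eta (D2 + delta) + (eta 0 + delta + D2))); first lra.
move=> w A z p o q pA NA Az [Np gp] so Nq qo; have Ap := NA _ Np; have Aq := NA _ Nq.
have Ao := seg_in so.
have [q' sq' pq'] : near_set D2 (seg A z o) p.
  apply: near_set_trans (gp q Nq) _ => x sx.
  by apply: (seg_near_ends delta0 eta0 pA) sx => //; rewrite mdistxx.
rewrite metric_sym in pq'.
have := seg_between delta0 eta0 pA Az Ap D20 so sq' pq'.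
by have := metric_triangle q o p; lra.
Qed.

Lemma near_between (r : R) : 0 <= r -> exists2 D, 0 <= D & forall w t b p,
  V w -> V t -> V b -> segment w t b -> near_set r (N w) p -> near_set r (N t) p ->
  near_set D (N b) p.
Proof.
move=> r0; have l0 := L10; exists (3 * (r + L1)); first lra.
move=> w t b p Vw Vt Vb sb pw pt.
apply: (@near_setW _ _ (3 * (r + L1)) _ (M b)) => //; first exact: MN.
apply: (coarse_between Vw Vt Vb sb).
- by apply: near_set_trans pw _ => q; exact: NM.
- by apply: near_set_trans pt _ => q; exact: NM.
Qed.

(** A geodesic between two gates is a side of a quadrilateral; by [gate_unique] it can
    be close to the sides leading to m and m' only near its ends. *)
Lemma gate_dichotomy (Dg : R) : 0 <= Dg -> exists2 D, 0 <= D & forall w A m m' p p',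
  V w -> piece delta eta A -> N w `<=` A -> A m -> A m' ->
  gate Dg A w m p -> gate Dg A w m' p' ->
  mdist p p' <= D \/ forall o, seg A p p' o -> near_set D (seg A m m') o.
Proof.
move=> Dg0; have [k k0 kP] := @seg_quasiconvex 0 (lexx 0); have d0 := delta0.
have [|D' D'0 uniq] := @gate_unique Dg (k + 2 * delta) Dg0; first lra.
pose E := k + 2 * delta + D'.
have E0 : 0 <= E by rewrite /E; lra.
exists (3 * E + 1); first lra.
move=> w A m m' p p' Vw pA NA Am Am' gm gm'.
have Np := gm.1; have Np' := gm'.1; have Ap := NA _ Np; have Ap' := NA _ Np'.
have three o : seg A p p' o ->
    [\/ near_set E (seg A m m') o, mdist o p <= E | mdist o p' <= E].
  move=> so; have near0 q : N w q -> near_set 0 (N w) q by move=> Nq; apply: near_set0.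
  have [b Nb ob] := kP w A p p' o Vw pA NA Ap Ap' (near0 _ Np) (near0 _ Np') so.
  have close z q x : A z -> gate Dg A w z q -> seg A z q x -> mdist o x <= 2 * delta ->
      mdist o q <= E.
    move=> Az gq sx ox; have bx : mdist b x <= k + 2 * delta.
      by have := metric_triangle b o x; rewrite (metric_sym b o); lra.
    have := uniq w A z q x b pA NA Az gq sx Nb bx.
    by have := metric_triangle o b q; rewrite /E; lra.
  have [x [xpm|xmp] ox] := seg_slim pA Ap Ap' Am so.
    apply: Or32; apply: (close m p x) => //; last lra.
    exact: (seg_sym pA).
  have [x' [xmm|xmp'] xx'] := seg_slim pA Am Ap' Am' xmp.
    by apply: Or31; exists x' => //; have := metric_triangle o x x'; rewrite /E; lra.
  apply: Or33; apply: (close m' p' x') => //.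
  by have := metric_triangle o x x'; lra.
have half q q' : A q -> A q' ->
    (forall o, seg A q q' o ->
      [\/ near_set E (seg A m m') o, mdist o q <= E | mdist o q' <= E]) ->
    mdist q q' <= 2 * E + 1 \/ near_set (2 * E + 1) (seg A m m') q.
  move=> Aq Aq' th; have [n [c [c0 cn cs cst]]] := seg_connected pA Aq Aq'.
  have P0 : mdist (c 0%N) q <= E by rewrite c0 mdistxx.
  have [all|[i [iln Pi nP]]] := first_failure (P := fun i => mdist (c i) q <= E) n P0.
    by left; have := all n (leqnn n); rewrite cn metric_sym; lra.
  have qc : mdist q (c i.+1) <= E + 1.
    have := metric_triangle q (c i) (c i.+1); have := metric_sym q (c i).
    by have := cst i; lra.
  have [h|//|h] := th _ (cs i.+1).
    by right; apply: near_set_le (near_set_dist qc h); lra.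
  by left; have := metric_triangle q (c i.+1) q'; lra.
have [h|h] := half p p' Ap Ap' three; first by left; lra.
have [|h'|h'] := half p' p Ap' Ap.
- move=> o /(seg_sym pA Ap' Ap) /three[]; [exact: Or31|exact: Or33|exact: Or32].
- by left; rewrite metric_sym; lra.
right=> o /three[ho|ho|ho].
- by apply: near_set_le ho; lra.
- by apply: near_set_le (near_set_dist ho h); lra.
- by apply: near_set_le (near_set_dist ho h'); lra.
Qed.

(** The property of nearest point projections to quasiconvex sets that survives
    composition; it bounds the image as soon as N w and N t are coarsely disjoint. *)
Definition contracting (D : R) w t (f : X -> X) : Prop :=
  (forall m, N t m -> N w (f m)) /\
  forall m m', N t m -> N t m' -> mdist (f m) (f m') <= D \/
    forall o, seg (N w) (f m) (f m') o -> near_set D (seg (N t) m m') o.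

Lemma contracting_lip D w t f (r : R) m m' : V w -> V t -> 0 <= D -> 0 <= r ->
  contracting D w t f ->
  N t m -> N t m' -> mdist m m' <= r -> mdist (f m) (f m') <= 2 * (D + eta r).
Proof.
move=> Vw Vt D0 r0 [fN fc] Nm Nm' mm; have er := eta0 r0.
have [h|h] := fc m m' Nm Nm'; first lra.
have small q : near_set D (seg (N t) m m') q -> mdist q m <= D + eta r.
  move=> [x sx qx]; have := seg_small (piece_N Vt) Nm Nm' r0 mm sx.
  by have := metric_triangle q x m; lra.
have h1 := small _ (h _ (seg_l (piece_N Vw) (fN _ Nm) (fN _ Nm'))).
have h2 := small _ (h _ (seg_r (piece_N Vw) (fN _ Nm) (fN _ Nm'))).
have := metric_triangle (f m) m (f m'); have := metric_sym m (f m'); lra.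
Qed.

Lemma contracting_comp (D1 D2 : R) : 0 <= D1 -> 0 <= D2 -> exists2 D, 0 <= D &
  forall w t s f g, V w -> V t -> V s -> contracting D1 w t f -> contracting D2 t s g ->
  contracting D w s (f \o g).
Proof.
move=> D10 D20; have e2 := eta0 D20; exists (2 * (D1 + eta D2) + D2); first lra.
move=> w t s f g Vw Vt Vs cf [gN gc]; have [fN fc] := cf; split=> [m Nm|m m' Nm Nm'] /=.
  exact/fN/gN.
have [h|h] := gc m m' Nm Nm'.
  by left; have := contracting_lip Vw Vt D10 D20 cf (gN _ Nm) (gN _ Nm') h; lra.
have [h'|h'] := fc _ _ (gN _ Nm) (gN _ Nm'); first by left; lra.
by right=> o /h' ho; apply: near_set_le (near_set_trans ho h); lra.
Qed.

Lemma contracting_id w : V w -> contracting 0 w w id.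
Proof. by move=> Vw; split=> // m m' Nm Nm'; right=> o so; exact: near_set0. Qed.

(** Adjacent vertices that are not linked are separated by a bounded edge space, and
    the projection between their pieces is constant. *)
Definition joined w t := [/\ V w, V t & linked w t \/ adjacent V w t].

Lemma joined_refl w : V w -> joined w w.
Proof. by move=> Vw; split=> //; left; exact: linked_refl. Qed.

Lemma joined_sym w t : joined w t -> joined t w.
Proof.
by move=> [Vw Vt [h|h]]; split=> //; [left; exact: linked_sym|right; exact: adjacent_sym].
Qed.

Lemma joined_sub w t b : joined w t -> V b -> segment w t b -> joined w b /\ joined b t.
Proof.
move=> [Vw Vt [h|h]] Vb sb.
  by have [h1 h2] := linked_sub h Vb sb; split; split=> //; left.
have [->|->] := vertex_edge_end treeV h sb Vb.
  by split; [exact: joined_refl|split=> //; right].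
by split; [split=> //; right|exact: joined_refl].
Qed.

Hypothesis rho_C : forall u t v, V u -> adjacent V t v -> (pi @` M u) t ->
  ~ (pi @` M u) v -> forall x y, segment t (pi x) v -> segment t (pi y) v ->
  mdist (rho u x) (rho u y) <= C.

Lemma not_arrow_exit w v : V w -> V v -> ~ arrow w v -> exists a a',
  [/\ adjacent V a a', (pi @` M w) a, ~ (pi @` M w) a', segment w v a' & segment w a' a].
Proof.
move=> Vw Vv /existsNP[b /not_implyP[Vb /not_implyP[sb nb]]].
have {}nb : ~ (pi @` M w) b by move=> [m Mm mb]; apply: nb; exists m.
suff main n a : V a -> (pi @` M w) a -> segment w b a -> mdist a b <= n%:R ->
    exists a a', [/\ adjacent V a a', (pi @` M w) a, ~ (pi @` M w) a', segment w b a'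
      & segment w a' a].
  have [n hn] := vertex_dist_nat treeV Vw Vb.
  have Mw : (pi @` M w) w by have [x [xw Mx _]] := vertex_point Vw; exists x.
  have [|a [a' [h1 h2 h3 h4 h5]]] := main n w Vw Mw (segment_l w b); first by rewrite hn.
  by exists a, a'; split=> //; have [] := segment_trans sb h4.
elim: n a => [|n IHn] a Va Ma sa ab.
  exfalso; apply: nb; rewrite (_ : b = a) //; apply: mdist_positivity.
  by have := metric_sym a b; have := mdist_ge0 a b; lra.
have ne : a <> b by move=> e; apply: nb; rewrite -e.
have [a' [aa sa' da]] := vertex_next treeV Va Vb ne; clear ne.
have [Va' _] : V a' /\ True by case: aa.
have [h1 h2] := segment_trans (segment_sym sa) (segment_sym sa').
have [Ma'|nMa'] := pselect ((pi @` M w) a').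
  by apply: (IHn a') => //; [exact: segment_sym|move: ab; rewrite -natr1; lra].
by exists a, a'; split=> //; exact: segment_sym.
Qed.

(** The pieces N w and N t are close to each other in at most two bounded clusters. A
    point close to both is close to a point of M w beyond the exit from the projection
    of M w, which rho w fixes, or likewise for M t, or it is close to the fibre over
    v, which lies beyond the exit. A path in the coarse intersection cannot jump from
    one cluster to the other. *)
Lemma far_bounded (D : R) : 0 <= D -> exists2 D', 0 <= D' & forall w t v p p',
  V w -> V t -> V v -> segment w t v -> ~ linked w v -> ~ linked v t -> N w p -> N w p' ->
  (forall o, seg (N w) p p' o -> near_set D (N t) o) -> mdist p p' <= D'.
Proof.
move=> D0; have [h1 h2 h3] := And3 L'0 C0 L10; pose r := D + L1.
have r0 : 0 <= r by rewrite /r; lra.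
have Lr : 0 <= L' * (2 * r) by apply: mulr_ge0 => //; lra.
pose E := r + L' * (2 * r) + L' + C.
have E0 : 0 <= E by rewrite /E; lra.
exists (4 * E + 1); first lra.
move=> w t v p p' Vw Vt Vv sv nwv nvt Np Np' near.
have nawv : ~ arrow w v by move=> h; apply: nwv; split=> //; left.
have natv : ~ arrow t v by move=> h; apply: nvt; split=> //; right.
have [a [a' [aa Ma nMa sva saa]]] := not_arrow_exit Vw Vv nawv.
have [c [c' [cc Mc nMc svc scc]]] := not_arrow_exit Vt Vv natv.
have [x0 xa] := surj a'; have [y0 yc] := surj c'.
have shadow u b b' z z' : V u -> adjacent V b b' -> (pi @` M u) b -> ~ (pi @` M u) b' ->
    segment u b' b -> pi z' = b' -> segment u (pi z) b' -> mdist (rho u z) (rho u z') <= C.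
  move=> Vu bb Mb nMb sub z'b sz; apply: (rho_C Vu bb Mb nMb).
    by have [] := segment_trans sz sub.
  by rewrite z'b; exact: segment_r.
have [n [d [d0 dn ds dst]]] := seg_connected (piece_N Vw) Np Np'.
rewrite -d0 -dn; apply: (@two_clusters R X E n d (rho w x0) (rho t y0)) => // i _.
have Nd : N w (d i) := seg_in (ds i).
have [m Mm dm] : near_set r (M w) (d i).
  by apply: near_set_le (NM Vw Nd); rewrite /r; lra.
have [m' Mm' dm'] : near_set r (M t) (d i).
  by apply: near_set_trans (near _ (ds i)) _ => q; exact: NM.
have [_ _ idw] := retr Vw; have [_ _ idt] := retr Vt; have [_ lw _] := retr Vw.
have [sm|nsm] := pselect (segment w (pi m) a').
  left; have := shadow w a a' m x0 Vw aa Ma nMa saa xa sm.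
  by rewrite idw //; have := metric_triangle (d i) m (rho w x0); rewrite /E; lra.
have [sm'|nsm'] := pselect (segment t (pi m') c').
  right; have := shadow t c c' m' y0 Vt cc Mc nMc scc yc sm'.
  by rewrite idt //; have := metric_triangle (d i) m' (rho t y0); rewrite /E; lra.
left; have [h|h] := tree_segment_slim treeV (pi m) sv.
  by case: nsm; have [] := segment_trans h sva.
have [h'|h'] := tree_segment_slim treeV (pi m') (segment_sym h).
  by case: nsm'; have [] := segment_trans h' svc.
have [y yv sy] := geodesic_crosses treeV gX lip (segment_sym h').
have my : mdist m y <= 2 * r.
  move: sy; rewrite /segment /= => sy; have := metric_triangle m (d i) m'.
  by have := metric_sym m (d i); have := mdist_ge0 y m'; lra.
have sy1 : segment w (pi y) a' by rewrite yv.
have := shadow w a a' y x0 Vw aa Ma nMa saa xa sy1.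
have := lw m y; rewrite (idw m Mm).
have : L' * mdist m y <= L' * (2 * r) by rewrite ler_wpM2l.
have := metric_triangle (d i) m (rho w x0); have := metric_triangle m (rho w y) (rho w x0).
rewrite /E; lra.
Qed.

Lemma step_exists w u : V w -> V u -> exists t,
  [/\ V t, segment w u t, joined w t, t = w -> w = u
    & forall b, V b -> segment w u b -> joined w b -> segment w t b].
Proof.
move=> Vw Vu; have [->|/eqP wu] := eqVneq w u.
  exists u; split=> //; [exact: segment_r|exact: joined_refl].
have [w' [ww' sw' dw']] := vertex_next treeV Vw Vu wu; clear wu.
have [_ Vw' ww1] := ww'; have [n dn] := vertex_dist_nat treeV Vw Vu.
pose Q k := `[< exists2 t, [/\ V t, segment w u t & joined w t] & mdist w t = k%:R >].
have Q1 : exists k, Q k.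
  by exists 1%N; apply/asboolP; exists w'; [split=> //; split=> //; right|rewrite ww1].
have Qn k : Q k -> (k <= n)%N.
  move=> /asboolP[t [Vt step _] tk]; rewrite -(ler_nat R) -tk -dn.
  by move: step; rewrite /segment /=; have := mdist_ge0 t u; lra.
case: (ex_maxnP Q1 Qn) => k /asboolP[t [Vt step rt] tk] kmax; exists t; split=> //.
  move=> tw; exfalso; have := kmax 1%N; move: tk; rewrite tw mdistxx => /esym/eqP.
  rewrite pnatr_eq0 => /eqP -> /(_ _); rewrite ltn0 => h; suff : false by [].
  by apply: h; apply/asboolP; exists w'; [split=> //; split=> //; right|rewrite ww1].
move=> b Vb sb rb; have [//|h] := tree_segment_slim treeV t sb.
have [j dj] := vertex_dist_nat treeV Vw Vb.
have jk : (j <= k)%N by apply: kmax; apply/asboolP; exists b.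
have [h1 _] := segment_trans_right step h.
suff -> : b = t by exact: segment_r.
apply: mdist_positivity; move: h1; rewrite /segment /= tk dj.
have : j%:R <= k%:R :> R by rewrite ler_nat.
by have := mdist_ge0 b t; have := metric_sym b t; lra.
Qed.

Section projections.
Variables (proj : T -> T -> X -> X) (edge_end : T -> T -> X) (Dg : R).
Hypothesis Dg0 : 0 <= Dg.
Hypothesis proj_id : forall w z, V w -> proj w w z = z.
Hypothesis proj_linked : forall w t z, linked w t -> w <> t -> (N w `|` N t) z ->
  gate Dg (N w `|` N t) w z (proj w t z).
Hypothesis proj_edge : forall w t z, adjacent V w t -> ~ linked w t ->
  proj w t z = edge_end w t.
Hypothesis edge_end_pi : forall w t, adjacent V w t -> pi (edge_end w t) = w.
Hypothesis edge_end_dist : forall w t, adjacent V w t ->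
  mdist (edge_end w t) (edge_end t w) <= 2.

Lemma proj_gate w t z : linked w t -> N t z -> gate Dg (N w `|` N t) w z (proj w t z).
Proof.
move=> wt Nz; have [Vw Vt _] := wt.
have [e|/eqP ne] := eqVneq w t; last by apply: proj_linked => //; right.
rewrite -e in Nz wt *; rewrite proj_id //; split=> // m Nm; apply: near_set0 => //.
by apply: (seg_l (piece_linked wt)); left.
Qed.

Lemma proj_in w t z : joined w t -> N t z -> N w (proj w t z).
Proof.
move=> [Vw Vt h] Nz; have [wt|nwt] := pselect (linked w t).
  by have [] := proj_gate wt Nz.
case: h => // wt; rewrite proj_edge //; apply: MN => //.
by have := @XM (edge_end w t); rewrite edge_end_pi //; apply.
Qed.

Lemma proj_contracting : exists2 D, 0 <= D & forall w t, joined w t ->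
  contracting D w t (proj w t).
Proof.
have [D1 D10 dich] := gate_dichotomy Dg0; have [D2 D20 close] := seg_pieces_close.
exists (D1 + 2 * D2); first lra.
move=> w t wt; split=> [m|m m' Nm Nm']; first exact: proj_in.
have [Vw Vt h] := wt; have [swt|nwt] := pselect (linked w t); last first.
  by case: h => // a; left; rewrite !proj_edge // mdistxx; lra.
have pY := piece_linked swt.
have gm := proj_gate swt Nm; have gm' := proj_gate swt Nm'.
have [wY tY] : N w `<=` N w `|` N t /\ N t `<=` N w `|` N t by split=> x; [left|right].
have [|h'] := dich w _ m m' _ _ Vw pY wY (tY _ Nm) (tY _ Nm') gm gm'.
  by left; lra.
right=> o so.
have x1 : near_set D2 (seg (N w `|` N t) (proj w t m) (proj w t m')) o.
  by apply: (close w (N w) _ _ _ _ Vw (piece_N Vw) pY _ wY gm.1 gm'.1 so).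
have o2 := near_set_trans x1 h'.
have : near_set (D2 + D1 + D2) (seg (N t) m m') o.
  by apply: near_set_trans o2 _ => q; apply: (close t) => //; exact: piece_N.
by apply: near_set_le; lra.
Qed.

(** The projection p of m to N w is close to N t, hence to N b, so the geodesic from m
    to p passes near the projection n of m to N b. The rest of it, from n to p, can be
    followed in all three pieces, so it passes near the projection p' of n to N w;
    uniqueness of gates identifies p' with p. *)
Lemma proj_trans : exists2 D, 0 <= D & forall w t b m, joined w t -> V b -> segment w t b ->
  N t m -> mdist (proj w t m) (proj w b (proj b t m)) <= D.
Proof.
have d0 := delta0; have g0 := Dg0; have e0 : 0 <= eta 0 by exact: eta0.
have [k k0 kP] := @seg_quasiconvex 0 (lexx 0).
pose r1 := Dg + k; have r10 : 0 <= r1 by rewrite /r1; lra.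
have [r2 r20 nbP] := near_between r10.
have [|k3 k30 ch3] := @seg_change (r1 + r2); first lra.
pose r3 := Dg + k3; have r30 : 0 <= r3 by rewrite /r3; lra.
have [|k4 k40 ch4] := @seg_change (r1 + r2 + r3); first lra.
have [|D D0 uniq] := @gate_unique Dg (Dg + (k4 + (k4 + (delta + eta 0)))) Dg0; first lra.
exists D => // w t b m wt Vb sb Nm; have [Vw Vt wt'] := wt.
have [->|/eqP nbw] := eqVneq b w; first by rewrite proj_id // mdistxx.
have [->|/eqP nbt] := eqVneq b t; first by rewrite (proj_id _ Vt) mdistxx.
have swt : linked w t.
  case: wt' => // a; have [e|e] := vertex_edge_end treeV a sb Vb.
    by case: nbw.
  by case: nbt.
clear nbw nbt.
have [swb sbt] := linked_sub swt Vb sb.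
have [pA pB pC] := And3 (piece_linked swt) (piece_linked sbt) (piece_linked swb).
set A := N w `|` N t in pA *; set B := N b `|` N t in pB *; set Y := N w `|` N b in pC *.
have [wA tA] : N w `<=` A /\ N t `<=` A by split=> x; [left|right].
have [bB tB] : N b `<=` B /\ N t `<=` B by split=> x; [left|right].
have [wY bY] : N w `<=` Y /\ N b `<=` Y by split=> x; [left|right].
have gp := proj_gate swt Nm; have gn := proj_gate sbt Nm.
set p := proj w t m in gp *; set n := proj b t m in gn *.
have gp' := proj_gate swb gn.1; set p' := proj w b n in gp' *.
have [Np Nn Np'] := And3 gp.1 gn.1 gp'.1.
have near0 u q : N u q -> near_set 0 (N u) q by move=> Nq; apply: near_set0.
have near_t u z q : linked u t -> gate Dg (N u `|` N t) u z q -> N t z -> near_set r1 (N t) q.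
  move=> ut [Nq gq] Nz; have [x Nx Nx'] := linked_common ut.
  apply: near_set_trans (gq x Nx) _ => y.
  apply: (kP t (N u `|` N t) z x y Vt (piece_linked ut)) => //; try exact: near0.
  - by right.
  - by left.
have [pt Npt ppt] := near_t w m p swt gp Nm.
have [nt Nnt nnt] := near_t b m n sbt gn Nm.
have [pb Npb ppb] : near_set r2 (N b) p.
  apply: (nbP w t b p) => //; first exact: near_set0.
  by exists pt.
have [nr1 nr2 nr3] := And3 (mdist_ge0 p pt) (mdist_ge0 p pb) k30.
have pbpt : mdist pb pt <= r1 + r2.
  by have := metric_triangle pb p pt; have := metric_sym pb p; lra.
(* n lies close to a geodesic from m to p *)
have [x1 sx1 nx1] : near_set r3 (seg A m p) n.
  apply: near_set_trans (gn.2 pb Npb) _ => q.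
  apply: (ch3 t B A m pb m p) => //.
  - exact: tB.
  - exact: bB.
  - exact: tA.
  - exact: wA.
  - by apply: near_set0 => //; lra.
  - by exists pt.
  - by rewrite mdistxx; lra.
  - by rewrite metric_sym; lra.
have Ax1 : A x1 := seg_in sx1.
(* so a geodesic from n to p, hence also p', follows it *)
have [q sq p'q] : near_set (Dg + (k4 + (k4 + (delta + eta 0)))) (seg A m p) p'.
  apply: near_set_trans (gp'.2 p Np) _ => q1 sq1.
  have [|||||||||q2 sq2 q12] := ch4 b Y B n p n pb q1 Vb pC pB bY bB.
  - exact: bY.
  - exact: wY.
  - exact: bB.
  - exact: bB.
  - by apply: near_set0 => //; lra.
  - by exists pb => //; lra.
  - by rewrite mdistxx; lra.
  - by lra.
  - exact: sq1.
  have [|||||||||q3 sq3 q23] := ch4 t B A n pb x1 p q2 Vt pB pA tB tA.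
  - exact: bB.
  - exact: bB.
  - exact: Ax1.
  - exact: wA.
  - by exists nt => //; lra.
  - by exists pt => //; lra.
  - by lra.
  - by rewrite metric_sym; lra.
  - exact: sq2.
  have Ap : A p := wA _ Np; have Am : A m := tA _ Nm.
  have [q4 sq4 q34] : near_set (delta + eta 0) (seg A p m) q3.
    apply: (seg_sub delta0 eta0 pA Ap Am _ (seg_sym pA Ax1 Ap sq3)).
    exact: (seg_sym pA Am Ap sx1).
  exists q4; first exact: (seg_sym pA Ap Am sq4).
  by have := metric_triangle q1 q2 q4; have := metric_triangle q2 q3 q4; lra.
rewrite metric_sym.
exact: (uniq w A m p q p' pA wA (tA _ Nm) gp sq Np' p'q).
Qed.

(** * Projections along greedy chains *)

Section steps.
Variable step : T -> T -> T.
Hypothesis step_spec : forall w u, V w -> V u ->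
  [/\ V (step w u), segment w u (step w u), joined w (step w u), step w u = w -> w = u
    & forall b, V b -> segment w u b -> joined w b -> segment w (step w u) b].

Lemma step_id u : V u -> step u u = u.
Proof. by move=> Vu; have [_ /segment_eq] := step_spec Vu Vu. Qed.

Fixpoint Proj_fuel n w u x :=
  if n is n'.+1 then proj w (step w u) (Proj_fuel n' (step w u) u x) else x.

Lemma Proj_fuel_id n u x : V u -> Proj_fuel n u u x = x.
Proof. by move=> Vu; elim: n => //= n IHn; rewrite step_id // IHn proj_id. Qed.

Lemma step_dist w u : V w -> V u -> w <> u -> mdist (step w u) u <= mdist w u - 1.
Proof.
move=> Vw Vu wu; have [Vt + _ tw _] := step_spec Vw Vu; rewrite /segment /= => swt.
have := st_separated treeV Vw Vt (fun e => wu (tw (esym e))).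
by clear wu tw; lra.
Qed.

Lemma Proj_fuel_stable n n' w u x : V w -> V u -> mdist w u <= n%:R -> mdist w u <= n'%:R ->
  Proj_fuel n w u x = Proj_fuel n' w u x.
Proof.
elim: n n' w => [|n IHn] n' w Vw Vu wn wn'; have [e|/eqP wu] := eqVneq w u.
- by rewrite e !Proj_fuel_id.
- by exfalso; have := st_separated treeV Vw Vu wu; clear wu; lra.
- by rewrite e !Proj_fuel_id.
case: n' wn' => [|n'] wn'.
  by exfalso; have := st_separated treeV Vw Vu wu; clear wu; lra.
have [Vt _ _ _ _] := step_spec Vw Vu; have := step_dist Vw Vu wu; clear wu => h /=.
by rewrite (IHn n') //; move: wn wn'; rewrite -!natr1; lra.
Qed.

(** The projection of a point x over a vertex to N w. The chain is chosen greedily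
    from w, but the projections are applied starting at the end of x. *)
Definition Proj w x := Proj_fuel (Num.truncn (mdist w (pi x))) w (pi x) x.

Lemma Proj_id x : V (pi x) -> Proj (pi x) x = x.
Proof. by move=> Vx; rewrite /Proj Proj_fuel_id. Qed.

Lemma Proj_step w x : V w -> V (pi x) ->
  Proj w x = proj w (step w (pi x)) (Proj (step w (pi x)) x).
Proof.
move=> Vw Vx; have [e|/eqP wx] := eqVneq w (pi x).
  by rewrite e step_id // Proj_id // proj_id.
have [n dn] := vertex_dist_nat treeV Vw Vx; have h := step_dist Vw Vx wx.
have [Vt _ _ _ _] := step_spec Vw Vx; have := st_separated treeV Vw Vx wx; clear wx.
rewrite /Proj dn natrK; case: n dn => [|n] dn; first by move=> h0; exfalso; lra.
move=> _ /=; congr proj; have [n' dn'] := vertex_dist_nat treeV Vt Vx.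
by apply: Proj_fuel_stable => //; rewrite ?dn' ?natrK //; move: h; rewrite dn dn' -natr1; lra.
Qed.

Lemma Proj_in w x : V w -> V (pi x) -> N w (Proj w x).
Proof.
move=> Vw Vx; have [n] := vertex_dist_nat treeV Vw Vx; move=> dn.
have {}dn : mdist w (pi x) <= n%:R by rewrite dn.
elim: n w Vw dn => [|n IHn] w Vw dn; have [e|/eqP wx] := eqVneq w (pi x).
- by rewrite e Proj_id //; apply: MN => //; exact: XM.
- by exfalso; have := st_separated treeV Vw Vx wx; clear wx; lra.
- by rewrite e Proj_id //; apply: MN => //; exact: XM.
have [Vt _ rt _ _] := step_spec Vw Vx; have h := step_dist Vw Vx wx; clear wx.
rewrite Proj_step //; apply: proj_in => //; apply: IHn => //.
by move: dn; rewrite -natr1; lra.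
Qed.

(** Take for v the neighbour of t1 towards u: the jump from w did not reach it, and if it
    were linked to t4 then so would be t2, whose jump only reached t3. *)
Lemma far_steps w u (t1 := step w u) (t2 := step t1 u) (t3 := step t2 u) (t4 := step t3 u) :
  V w -> V u -> t4 <> u ->
  exists v, [/\ V t4, V v, segment w t4 v, ~ linked w v & ~ linked v t4].
Proof.
move=> Vw Vu t4u.
have [V1 s1 r1 _ f1] := step_spec Vw Vu; have [V2 s2 r2 _ f2] := step_spec V1 Vu.
have [V3 s3 r3 _ f3] := step_spec V2 Vu; have [V4 s4 r4 n4 _] := step_spec V3 Vu.
rewrite -/t1 in V1 s1 r1 f1 V2 s2 r2 f2 V3 s3 r3 f3 V4 s4 r4 n4.
rewrite -/t2 in V2 s2 r2 f2 V3 s3 r3 f3 V4 s4 r4 n4.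
rewrite -/t3 in V3 s3 r3 f3 V4 s4 r4 n4; rewrite -/t4 in V4 s4 r4 n4.
have t1u : t1 <> u by move=> e; apply: t4u; rewrite /t4 /t3 /t2 e !step_id.
have [v [tv sv _]] := vertex_next treeV V1 Vu t1u; have [_ Vv t1v] := tv.
have s24 : segment t2 u t4 by have [] := segment_trans_right s3 s4.
have [s142 _] := segment_trans_right s2 s24.
have s12v : segment t1 t2 v by apply: f2 => //; split=> //; right.
have [s14v sv42] := segment_trans s142 s12v.
have [_ s1u4] := segment_trans_right s2 s24; have [sw41 _] := segment_trans_right s1 s1u4.
exists v; split=> //; first by have [] := segment_trans_right sw41 s14v.
- move=> wv; have [swv1 swuv] := segment_trans_right s1 sv.
  have sw1v : segment w t1 v by apply: f1 => //; split=> //; left.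
  by apply: (vertex_adjacent_neq tv); exact: segment_anti sw1v swv1.
- move=> v4; have [_ h] := linked_sub v4 V2 sv42.
  have h1 : segment t2 t3 t4 by apply: f3 => //; split=> //; left.
  have [h2 _] := segment_trans_right s3 s4.
  have e : t3 = t4 by exact: segment_anti h1 h2.
  by apply: t4u; rewrite -[LHS]e; apply: n4.
Qed.

Lemma far_contracting (D : R) : 0 <= D -> exists2 D', 0 <= D' & forall w u f,
  V w -> V u -> let t := iter 4 (step^~ u) w in t <> u -> contracting D w t f ->
  forall z z', N t z -> N t z' -> mdist (f z) (f z') <= D'.
Proof.
move=> D0; have [D1 D10 far] := far_bounded D0; exists (D + D1); first lra.
move=> w u f Vw Vu t tu [fN fc] z z' Nz Nz'.
have [v [Vt Vv sv n1 n2]] := far_steps Vw Vu tu.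
have [h|h] := fc z z' Nz Nz'; first lra.
have : mdist (f z) (f z') <= D1.
  apply: (far w t v) => //; [exact: fN|exact: fN|].
  by move=> o /h[q sq oq]; exists q => //; exact: seg_in sq.
lra.
Qed.

(** The k-th vertex of the interleaved chain w, b, step w, step b, and so on, in which
    consecutive vertices are joined and ordered towards u. *)
Fixpoint leap k w b u := if k is k'.+1 then leap k' b (step w u) u else w.

Lemma Proj_unroll k : exists2 D, 0 <= D & forall w b x, V (pi x) -> joined w b ->
  segment w (pi x) b -> exists f z1 z2,
  [/\ contracting D w (leap k w b (pi x)) f,
      N (leap k w b (pi x)) z1 /\ N (leap k w b (pi x)) z2,
      mdist (Proj w x) (f z1) <= D, mdist (proj w b (Proj b x)) (f z2) <= D
    & leap k w b (pi x) = pi x -> z1 = z2].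
Proof.
have [Dc Dc0 prc] := proj_contracting; have [Dt Dt0 prt] := proj_trans.
elim: k => [|k [D D0 IHk]].
  exists 0 => // w b x Vx wb sb; have [Vw Vb _] := wb.
  exists id, (Proj w x), (proj w b (Proj b x)); split; rewrite /= ?mdistxx //.
  - exact: contracting_id.
  - by split; [exact: Proj_in|apply: proj_in => //; exact: Proj_in].
  - move=> e; move: sb; rewrite e => /segment_eq ->.
    by rewrite Proj_id // proj_id.
have [D1 D10 comp] := contracting_comp Dc0 D0; have eD := eta0 D0.
exists (D1 + Dt + 2 * (Dc + eta D)); first lra.
move=> w b x Vx wb sb; have [Vw Vb _] := wb.
have [Vt seg_t rt _ ft] := step_spec Vw Vx; set t := step w (pi x) in Vt seg_t rt ft *.
have sbt : segment w t b by exact: ft.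
have [_ bt] := joined_sub rt Vb sbt.
have [_ sbxt] := segment_trans seg_t sbt.
have sbu : segment b (pi x) t by exact: sbxt.
have [f [z1 [z2 [cf [N1 N2] h1 h2 e12]]]] := IHk b t x Vx bt sbu.
have Ve : V (leap k b t (pi x)).
  clear -step_spec Vb Vt Vx; elim: k b t Vb Vt => //= k IHk b t Vb Vt; apply: IHk => //.
  by have [] := step_spec Vb Vx.
exists (proj w b \o f), z2, z1; split=> //.
- have [c1 c2] := comp w b _ _ f Vw Vb Ve (prc w b wb) cf; split=> // m m' Nm Nm'.
  have [h|h] := c2 m m' Nm Nm'; first by left; lra.
  by right=> o /h; apply: near_set_le; lra.
- rewrite Proj_step // -/t; have := prt w t b (Proj t x) rt Vb sbt (Proj_in Vt Vx).
  have := contracting_lip Vw Vb Dc0 D0 (prc w b wb) (proj_in bt (Proj_in Vt Vx)) (cf.1 _ N2) h2.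
  have := metric_triangle (proj w t (Proj t x)) (proj w b (proj b t (Proj t x))) (proj w b (f z2)).
  by rewrite /=; lra.
- have := contracting_lip Vw Vb Dc0 D0 (prc w b wb) (Proj_in Vb Vx) (cf.1 _ N1) h1.
  by rewrite /=; lra.
- by move=> /e12 ->.
Qed.

(** The greedy chains from w and from b both refine to the interleaved chain, and
    each refinement is an instance of [proj_trans]. After eight vertices, four jumps
    of the chain from w have been made, and both sides lie in a bounded set. *)
Lemma Proj_through : exists2 D, 0 <= D & forall w b x, V (pi x) -> joined w b ->
  segment w (pi x) b -> mdist (Proj w x) (proj w b (Proj b x)) <= D.
Proof.
have [D D0 un] := Proj_unroll 8; have [D1 D10 far] := far_contracting D0.
exists (2 * D + D1); first lra.
move=> w b x Vx wb sb; have [f [z1 [z2 [cf [N1 N2] h1 h2 e12]]]] := un w b x Vx wb sb.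
have [Vw _ _] := wb.
have h : mdist (f z1) (f z2) <= D1.
  have [e|ne] := pselect (leap 8 w b (pi x) = pi x).
    by rewrite (e12 e) mdistxx.
  exact: (far w (pi x) f Vw Vx ne cf).
have := metric_triangle (Proj w x) (f z1) (proj w b (Proj b x)).
have := metric_triangle (f z1) (f z2) (proj w b (Proj b x)).
by have := metric_sym (f z2) (proj w b (Proj b x)); lra.
Qed.

Lemma step_common w b u u' : V w -> V b -> V u -> V u' -> ~ joined w b ->
  segment w u b -> segment w u' b -> step w u = step w u' /\ segment (step w u) u b.
Proof.
move=> Vw Vb Vu Vu' nwb sb sb'.
have before v : V v -> segment w v b -> segment w b (step w v).
  move=> Vv sv; have [Vt s r _ f] := step_spec Vw Vv.
  have [//|h] := tree_segment_slim treeV b s.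
  have [h1 _] := segment_trans_right sv (segment_sym (segment_sym h)).
  by case: nwb; have [] := joined_sub r Vb h1.
have h := before u Vu sb; have h' := before u' Vu' sb'.
have [Vt s r _ f] := step_spec Vw Vu; have [Vt' s' r' _ f'] := step_spec Vw Vu'.
have [h1 _] := segment_trans sb' h; have [h2 _] := segment_trans sb h'.
split; last by have [] := segment_trans sb h.
apply: (@segment_anti _ _ w); [exact: f|exact: f'].
Qed.

Definition dichotomy (D : R) w b y z : Prop := mdist (Proj w y) (Proj w z) <= D \/
  forall o, seg (N w) (Proj w y) (Proj w z) o -> near_set D (seg (N b) (Proj b y) (Proj b z)) o.

Lemma dichotomy_image (D1 D : R) w t b y z f : V w -> V t -> V (pi y) -> V (pi z) ->
  0 <= D1 -> 0 <= D ->
  contracting D1 w t f -> Proj w y = f (Proj t y) -> Proj w z = f (Proj t z) ->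
  dichotomy D t b y z -> dichotomy (2 * (D1 + eta D) + D) w b y z.
Proof.
move=> Vw Vt Vy Vz D10 D0 cf ey ez; have eD := eta0 D0.
have [N1 N2] := (Proj_in Vt Vy, Proj_in Vt Vz).
rewrite /dichotomy ey ez => -[h|h].
  by left; have := contracting_lip Vw Vt D10 D0 cf N1 N2 h; lra.
have [_ fc] := cf; have [h'|h'] := fc _ _ N1 N2; first by left; lra.
by right=> o /h' ho; apply: near_set_le (near_set_trans ho h); lra.
Qed.

(** As long as the chain from w has not reached a vertex joined to b, it does not
    distinguish y from z, and both projections factor through the same vertex e. *)
Lemma dichotomy_unroll k : exists2 D, 0 <= D & forall w b y z, V w -> V b ->
  V (pi y) -> V (pi z) -> segment w (pi y) b -> segment w (pi z) b ->
  let e := iter k (step^~ (pi y)) w in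
  dichotomy D w b y z \/ exists f, [/\ contracting D w e f, V e, Proj w y = f (Proj e y),
    Proj w z = f (Proj e z) & segment e (pi y) b].
Proof.
have [Dc Dc0 prc] := proj_contracting; have [Dp Dp0 thr] := Proj_through.
have d0 := delta0; have ep := eta0 Dp0.
elim: k => [|k [D D0 IHk]].
  exists 0 => // w b y z Vw Vb Vy Vz sy sz; right; exists id; split=> //.
  exact: contracting_id.
have [D1 D10 comp] := contracting_comp Dc0 D0; have eD := eta0 D0.
pose D2 := (2 * delta + eta Dp + Dp) + Dc + 2 * Dp.
exists (D1 + (2 * (Dc + eta D) + D) + D2); first by rewrite /D2; lra.
move=> w b y z Vw Vb Vy Vz sy sz.
have [wb|nwb] := pselect (joined w b).
  left; have [ty tz] := (thr w b y Vy wb sy, thr w b z Vz wb sz).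
  have [Ny Nz] := (Proj_in Vb Vy, Proj_in Vb Vz).
  have [_ fc] := prc w b wb; have [h|h] := fc _ _ Ny Nz.
    left; have := metric_triangle (Proj w y) (proj w b (Proj b y)) (Proj w z).
    have := metric_triangle (proj w b (Proj b y)) (proj w b (Proj b z)) (Proj w z).
    by have := metric_sym (Proj w z) (proj w b (Proj b z)); rewrite /D2; lra.
  right=> o so.
  have := seg_near_ends delta0 eta0 (piece_N Vw) (Proj_in Vw Vy) (Proj_in Vw Vz)
    (proj_in wb Ny) (proj_in wb Nz) Dp0 ty tz so.
  by move=> ho; apply: near_set_le (near_set_trans ho h); rewrite /D2; lra.
have [e s] := step_common Vw Vb Vy Vz nwb sy sz.
have [_ s'] := step_common Vw Vb Vz Vy nwb sz sy; rewrite -e in s'.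
have [Vt _ rt _ _] := step_spec Vw Vy.
have [ey ez] := (Proj_step Vw Vy, Proj_step Vw Vz); rewrite -e in ez.
rewrite iterSr; have [h|[f [cf Ve fy fz se]]] := IHk (step w (pi y)) b y z Vt Vb Vy Vz s s'.
  left; have := dichotomy_image Vw Vt Vy Vz Dc0 D0 (prc _ _ rt) ey ez h.
  move=> [h'|h']; [left|right]; first by rewrite /D2; lra.
  by move=> o /h'; apply: near_set_le; rewrite /D2; lra.
right; exists (proj w (step w (pi y)) \o f); split=> //.
- have [c1 c2] := comp w _ _ _ f Vw Vt Ve (prc _ _ rt) cf; split=> // m m' Nm Nm'.
  have [h|h] := c2 m m' Nm Nm'; first by left; rewrite /D2; lra.
  by right=> o /h; apply: near_set_le; rewrite /D2; lra.
- by rewrite ey fy.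
- by rewrite ez fz.
Qed.

(** Points beyond b project to N w through N b, and the composite is contracting with
    uniform constants: after four jumps its image is bounded anyway. *)
Lemma Proj_dichotomy : exists2 D, 0 <= D & forall w b y z, V w -> V b -> V (pi y) ->
  V (pi z) -> segment w (pi y) b -> segment w (pi z) b -> dichotomy D w b y z.
Proof.
have [D D0 un] := dichotomy_unroll 4; have [D1 D10 far] := far_contracting D0.
exists (D + D1); first lra.
move=> w b y z Vw Vb Vy Vz sy sz.
have [[h|h]|[f [cf Ve fy fz se]]] := un w b y z Vw Vb Vy Vz sy sz.
- by left; lra.
- by right=> o /h; apply: near_set_le; lra.
have [e|ne] := pselect (iter 4 (step^~ (pi y)) w = pi y); last first.
  left; rewrite fy fz; apply: (@le_trans _ _ D1); last by lra.
  by apply: (far w (pi y) f Vw Vy ne cf); exact: Proj_in.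
have be : b = iter 4 (step^~ (pi y)) w by move: se; rewrite e => /segment_eq ->.
rewrite -be in cf fy fz; have [_ fc] := cf.
rewrite /dichotomy fy fz; have [h|h] := fc _ _ (Proj_in Vb Vy) (Proj_in Vb Vz).
  by left; lra.
by right=> o /h; apply: near_set_le; lra.
Qed.

(** For adjacent vertices, failing to be linked means that M w misses the fibre over t,
    so rho w has a bounded image beyond the edge. *)
Lemma not_linked_shadow w t : adjacent V w t -> ~ linked w t ->
  (pi @` M w) w /\ ~ (pi @` M w) t.
Proof.
move=> wt nwt; have [Vw Vt _] := wt; have [x [xw Mx _]] := vertex_point Vw.
split; first by exists x.
move=> [m Mm mt]; apply: nwt; split=> //; left=> b Vb sb.
by have [->|->] := vertex_edge_end treeV wt sb Vb; [exists x|exists m].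
Qed.

Lemma proj_near (r : R) : 0 <= r -> exists2 D, 0 <= D & forall w t x y z, joined w t ->
  segment w (pi x) t -> pi y = w -> N t z -> mdist x y <= r -> mdist x z <= r ->
  mdist x (proj w t z) <= D.
Proof.
move=> r0; have er : 0 <= eta (2 * r) by apply: eta0; lra.
have [h1 h2 g0] := And3 L'0 C0 Dg0; have h3 : 0 <= L' * r by apply: mulr_ge0.
exists ((r + L' * r + L' + C + L' * 2 + L') + (r + Dg + eta (2 * r))); first lra.
move=> w t x y z wt sx yw Nz xy xz; have [Vw Vt wt'] := wt.
have My : M w y by have := @XM y; rewrite yw; apply.
have Ny := MN Vw My.
have yz : mdist z y <= 2 * r.
  by have := metric_triangle z x y; have := metric_sym z x; lra.
have [swt|nwt] := pselect (linked w t).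
  have [Np gp] := proj_gate swt Nz; have [q sq pq] := gp y Ny.
  have Yz : (N w `|` N t) z by right.
  have Yy : (N w `|` N t) y by left.
  have r20 : 0 <= 2 * r by lra.
  have := seg_small (piece_linked swt) Yz Yy r20 yz sq.
  have := metric_triangle x z (proj w t z); have := metric_triangle z q (proj w t z).
  by have := metric_sym q z; have := metric_sym q (proj w t z); lra.
case: wt' => // a; rewrite proj_edge //; have [Mw nMt] := not_linked_shadow a nwt.
have [_ lw idw] := retr Vw.
have Mc : M w (edge_end w t) by have := @XM (edge_end w t); rewrite edge_end_pi //; apply.
have c2 : segment w (pi (edge_end t w)) t.
  by rewrite (edge_end_pi (adjacent_sym a)); exact: segment_r.
have := rho_C Vw a Mw nMt sx c2; have := lw x y; have := lw (edge_end w t) (edge_end t w).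
rewrite (idw y My) (idw _ Mc); have cd := edge_end_dist a.
have : L' * mdist (edge_end w t) (edge_end t w) <= L' * 2 by rewrite ler_wpM2l.
have : L' * mdist x y <= L' * r by rewrite ler_wpM2l.
have := metric_triangle x y (edge_end w t); have := metric_triangle y (rho w x) (edge_end w t).
have := metric_triangle (rho w x) (rho w (edge_end t w)) (edge_end w t).
have := metric_sym y (rho w x); have := metric_sym (rho w (edge_end t w)) (edge_end w t).
lra.
Qed.

Lemma Proj_near_steps (r : R) k : 0 <= r -> exists2 D, 0 <= D & forall w x y, V w ->
  V (pi x) -> pi y = w -> mdist x y <= r -> mdist w (pi x) <= k%:R ->
  mdist x (Proj w x) <= D.
Proof.
move=> r0; elim: k => [|k [D D0 IHk]].
  exists 0 => // w x y Vw Vx yw xy wx; have -> : w = pi x.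
    by apply: mdist_positivity; have := mdist_ge0 w (pi x); lra.
  by rewrite Proj_id // mdistxx.
have [|D' D'0 prn] := @proj_near (r + D); first lra.
exists D' => // w x y Vw Vx yw xy wx.
have [e|/eqP ne] := eqVneq w (pi x); first by rewrite e Proj_id // mdistxx.
have [Vt s r' _ _] := step_spec Vw Vx; have h := step_dist Vw Vx ne; clear ne.
have s' : segment (pi x) (pi y) (step w (pi x)) by rewrite yw; exact: segment_sym.
have [z zt sz] := geodesic_crosses treeV gX lip s'.
rewrite (Proj_step Vw Vx); apply: (prn w _ x y) => //; first exact: Proj_in.
  by lra.
apply: (@le_trans _ _ D); last lra.
apply: (IHk _ x z) => //; first by move: sz; rewrite /segment /=; have := mdist_ge0 z y; lra.
by move: wx; rewrite -natr1; lra.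
Qed.

(** A short geodesic from x to the fibre over w crosses the fibres over all vertices of
    the chain, and there are at most r of them. *)
Lemma Proj_near (r : R) : 0 <= r -> exists2 D, 0 <= D & forall w x y, V w ->
  V (pi x) -> pi y = w -> mdist x y <= r -> mdist x (Proj w x) <= D.
Proof.
move=> r0; have [D D0 h] := Proj_near_steps (Num.truncn r).+1 r0; exists D => //.
move=> w x y Vw Vx yw xy; apply: (h w x y) => //.
have /andP[_ /ltW] := truncn_itv r0; apply: le_trans.
by rewrite -yw metric_sym; apply: le_trans (lip _ _) xy.
Qed.

(** Where a geodesic from N w to N t leaves N w, it is close to the gate or has not
    yet passed it. *)
Lemma gate_switch : exists2 D, 0 <= D & forall w t x y o, linked w t -> N w x -> N t y ->
  seg (N w `|` N t) x y o -> N w o -> near_set D (seg (N w) x (proj w t y)) o.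
Proof.
have d0 := delta0; have [D1 D10 uniq] := gate_unique Dg0 delta0.
have [D2 D20 close] := seg_pieces_close.
exists (delta + D2 + D1); first lra.
move=> w t a b o wt Na Nb so No; have [Vw Vt _] := wt; have pY := piece_linked wt.
have [wY tY] : N w `<=` N w `|` N t /\ N t `<=` N w `|` N t by split=> x; [left|right].
have gb := proj_gate wt Nb; have Nq := gb.1.
have [x [sx|sx] ox] := seg_slim pY (wY _ Na) (tY _ Nb) (wY _ Nq) so.
  have h := close w _ _ _ _ _ Vw pY (piece_N Vw) wY (fun _ h => h) Na Nq sx.
  by apply: near_set_le (near_set_dist ox h); lra.
exists (proj w t b); first exact: (seg_r (piece_N Vw)).
have := uniq w _ b _ x o pY wY (tY _ Nb) gb (seg_sym pY (wY _ Nq) (tY _ Nb) sx) No ox.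
by lra.
Qed.

(** A geodesic from the projection of x to N w to the projection of y to N t has to
    switch from N w to N t; the switching point is close to both geodesics. *)
Lemma Proj_consecutive : exists2 D, 0 <= D & forall w t x y, adjacent V w t -> V (pi x) ->
  V (pi y) -> segment (pi x) t w -> segment w (pi y) t -> exists p q,
  [/\ seg (N w) (Proj w x) (Proj w y) p, seg (N t) (Proj t x) (Proj t y) q & mdist p q <= D].
Proof.
have [D1 D10 sw] := gate_switch; have [Dp Dp0 thr] := Proj_through.
have d0 := delta0; have ep := eta0 Dp0.
pose E := D1 + (2 * delta + eta Dp + Dp).
exists (2 * Dp + 2 + 2 * E + 1); first by rewrite /E; lra.
move=> w t x y wt Vx Vy sx sy; have [Vw Vt _] := wt.
have rwt : joined w t by split=> //; right.
have rtw := joined_sym rwt.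
have tx := thr t w x Vx rtw (segment_sym sx); have ty := thr w t y Vy rwt sy.
have [Na Nb] := (Proj_in Vw Vx, Proj_in Vt Vy).
have [Na' Nb'] := (Proj_in Vt Vx, Proj_in Vw Vy).
have [swt|nwt] := pselect (linked w t); last first.
  exists (Proj w y), (Proj t x); split; [exact: (seg_r (piece_N Vw))|exact: (seg_l (piece_N Vt))|].
  have tw := adjacent_sym wt; have ntw : ~ linked t w by move=> /linked_sym.
  rewrite proj_edge // in tx; rewrite proj_edge // in ty.
  have := edge_end_dist wt; have := metric_triangle (Proj w y) (edge_end w t) (Proj t x).
  have := metric_triangle (edge_end w t) (edge_end t w) (Proj t x); have := metric_sym (edge_end t w) (Proj t x).
  by rewrite /E; lra.
have pY := piece_linked swt.
have [wY tY] : N w `<=` N w `|` N t /\ N t `<=` N w `|` N t by split=> z; [left|right].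
have [n [c [c0 cn cs cst]]] := seg_connected pY (wY _ Na) (tY _ Nb).
have [i [j [Ni Nj cij]]] : exists i j, [/\ N w (c i), N t (c j) & mdist (c i) (c j) <= 1].
  have Nc0 : N w (c 0%N) by rewrite c0.
  have [all|[i [iln Pi nP]]] := first_failure (P := fun i => N w (c i)) n Nc0.
    by exists n, n; split; [exact: all|rewrite cn|rewrite mdistxx].
  by exists i, i.+1; split=> //; have [] := seg_in (cs i.+1).
have [p seg_p pc] : near_set E (seg (N w) (Proj w x) (Proj w y)) (c i).
  apply: near_set_trans (sw w t _ _ _ swt Na Nb (cs i) Ni) _ => q.
  apply: (seg_near_ends delta0 eta0 (piece_N Vw)) => //; first exact: proj_in.
    by rewrite mdistxx.
  by rewrite metric_sym.
have [q sq qc] : near_set E (seg (N t) (Proj t x) (Proj t y)) (c j).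
  have csj : seg (N t `|` N w) (Proj t y) (Proj w x) (c j).
    by rewrite setUC; exact: (seg_sym pY (wY _ Na) (tY _ Nb)).
  apply: near_set_trans (sw t w _ _ _ (linked_sym swt) Nb Na csj Nj) _ => q sq.
  have Nq := proj_in rtw Na.
  have := seg_sym (piece_N Vt) Nb Nq sq.
  apply: (seg_near_ends delta0 eta0 (piece_N Vt)) => //; last by rewrite mdistxx.
  by rewrite metric_sym.
exists p, q; split=> //.
have := metric_triangle p (c i) q; have := metric_triangle (c i) (c j) q.
by have := metric_sym p (c i); lra.
Qed.

(** Only vertices w between pi x and pi y are used: x is far from its projections to
    the other pieces. *)
Definition guess x y : set X :=
  [set p | exists2 w, V w /\ segment (pi x) (pi y) w & seg (N w) (Proj w x) (Proj w y) p].

Definition over_vertices : set X := [set x | V (pi x)].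

Lemma guess_sym x y p : V (pi x) -> V (pi y) -> guess x y p -> guess y x p.
Proof.
move=> Vx Vy [w [Vw sw] wp]; exists w; first by split=> //; exact: segment_sym.
exact: (seg_sym (piece_N Vw) (Proj_in Vw Vx) (Proj_in Vw Vy)).
Qed.

Lemma guess_small (r : R) : 0 <= r -> exists2 D, 0 <= D & forall x y p,
  V (pi x) -> V (pi y) -> mdist x y <= r -> guess x y p -> mdist p x <= D.
Proof.
move=> r0; have [D D0 nP] := Proj_near r0.
have e : 0 <= eta (2 * D + r) by apply: eta0; lra.
exists (eta (2 * D + r) + D); first lra.
move=> x y p Vx Vy xy [w [Vw sw] seg_p].
have [z zw sz] := geodesic_crosses treeV gX lip sw.
have [xz yz] : mdist x z <= r /\ mdist y z <= r.
  move: sz; rewrite /segment /=; have := metric_sym z y.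
  by have := mdist_ge0 x z; have := mdist_ge0 z y; split; lra.
have hx := nP w x z Vw Vx zw xz; have hy := nP w y z Vw Vy zw yz.
have Pd : mdist (Proj w x) (Proj w y) <= 2 * D + r.
  have := metric_triangle (Proj w x) x (Proj w y); have := metric_triangle x y (Proj w y).
  by have := metric_sym x (Proj w x); lra.
have Dr0 : 0 <= 2 * D + r by lra.
have := seg_small (piece_N Vw) (Proj_in Vw Vx) (Proj_in Vw Vy) Dr0 Pd seg_p.
have := metric_triangle p (Proj w x) x; have := metric_sym x (Proj w x); lra.
Qed.

(** If w separates x from z, the geodesic of N w for x and z is part of the guess, and
    the one for z and y is handled at the branch vertex of w, y and z. *)
Lemma guess_slim : exists2 D, 0 <= D & forall x y z, V (pi x) -> V (pi y) -> V (pi z) ->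
  guess x y `<=` near_set D (guess x z `|` guess z y).
Proof.
have [D D0 dich] := Proj_dichotomy; have d0 := delta0; have eD := eta0 D0.
exists (delta + D + eta D); first lra.
have main x y z p w : V (pi x) -> V (pi y) -> V (pi z) -> V w ->
    segment (pi x) (pi z) w -> seg (N w) (Proj w z) (Proj w y) p ->
    near_set (D + eta D) (guess x z `|` guess z y) p.
  move=> Vx Vy Vz Vw sxz seg_p.
  have [b [Vb sy sz syz]] := vertex_median treeV Vw Vy Vz.
  have [Nx Ny Nz] := And3 (Proj_in Vw Vx) (Proj_in Vw Vy) (Proj_in Vw Vz).
  have [h|h] := dich w b z y Vw Vb Vz Vy sz sy.
    exists (Proj w z); last by have := seg_small (piece_N Vw) Nz Ny D0 h seg_p; lra.
    by left; exists w => //; exact: (seg_r (piece_N Vw)).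
  have [q sq pq] := h p seg_p; exists q; last lra.
  by right; exists b => //; split=> //; exact: segment_sym.
move=> x y z Vx Vy Vz p [w [Vw sw] seg_p].
have [Nx Ny Nz] := And3 (Proj_in Vw Vx) (Proj_in Vw Vy) (Proj_in Vw Vz).
have [q sq pq] := seg_slim (piece_N Vw) Nx Ny Nz seg_p.
have close S : near_set (D + eta D) S q -> near_set (delta + D + eta D) S p.
  by move=> qS; apply: near_set_le (near_set_dist pq qS); lra.
have [sxz|szy] := tree_segment_slim treeV (pi z) sw.
  case: sq => sq; last exact/close/(main x y z q w).
  by apply: near_set_le (_ : near_set delta _ _); [lra|exists q => //; left; exists w].
have {}szy := segment_sym szy.
case: sq => sq.
  apply/close; have sq' := seg_sym (piece_N Vw) Nx Nz sq.
  have [q' [q's|q's] qq'] := main y x z q w Vy Vx Vz Vw szy sq'; exists q' => //.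
    by right; exact: guess_sym.
  by left; exact: guess_sym.
apply: near_set_le (_ : near_set delta _ _); [lra|exists q => //; right; exists w => //].
by split=> //; exact: segment_sym.
Qed.

Lemma seg_reach A x y p : piece delta eta A -> A x -> A y -> seg A x y p ->
  exists n, reach 1 (near_set (delta + eta 0) (seg A x y)) n x p.
Proof.
move=> pA Ax Ay seg_p; have [n [c [c0 cn cs cst]]] := seg_connected pA Ax (seg_in seg_p).
exists n, c; split=> // i _; exact: (seg_sub delta0 eta0 pA Ax Ay seg_p (cs i)).
Qed.

Lemma guess_connected : exists2 D, 0 <= D & forall x y, V (pi x) -> V (pi y) ->
  exists n, reach D (near_set D (guess x y)) n x y.
Proof.
have [D D0 con] := Proj_consecutive; have d0 := delta0.
have e0 : 0 <= eta 0 by exact: eta0.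
pose E := D + 1 + (delta + eta 0).
have [E1 E2 E3] : [/\ 1 <= E, D <= E & delta + eta 0 <= E] by rewrite /E; split; lra.
exists E; first lra.
move=> x y Vx Vy; have [n dn] := vertex_dist_nat treeV Vx Vy.
have inguess w : V w -> segment (pi x) (pi y) w ->
    near_set (delta + eta 0) (seg (N w) (Proj w x) (Proj w y)) `<=` near_set E (guess x y).
  by move=> Vw sw p; apply: near_setW => // q sq; exists w.
suff main (k : nat) w : V w -> segment (pi x) (pi y) w -> mdist w (pi y) <= k%:R ->
    exists j : nat, reach E (near_set E (guess x y)) j (Proj w x) y.
  have := main n (pi x) Vx (segment_l (pi x) (pi y)); rewrite Proj_id // dn; exact.
elim: k w => [|k IHk] w Vw sw wk; have [e|/eqP ne] := eqVneq w (pi y).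
- rewrite e in Vw sw *; have Np := seg_r (piece_N Vw) (Proj_in Vw Vx) (Proj_in Vw Vy).
  have [m rm] := seg_reach (piece_N Vw) (Proj_in Vw Vx) (Proj_in Vw Vy) Np.
  exists m; rewrite -[X in reach _ _ _ _ X](Proj_id Vy).
  exact: reachW E1 (inguess _ Vw sw) rm.
- by exfalso; have := st_separated treeV Vw Vy ne; clear ne; lra.
- rewrite e in Vw sw *; have Np := seg_r (piece_N Vw) (Proj_in Vw Vx) (Proj_in Vw Vy).
  have [m rm] := seg_reach (piece_N Vw) (Proj_in Vw Vx) (Proj_in Vw Vy) Np.
  exists m; rewrite -[X in reach _ _ _ _ X](Proj_id Vy).
  exact: reachW E1 (inguess _ Vw sw) rm.
have [t [wt seg_t dt]] := vertex_next treeV Vw Vy ne; clear ne.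
have [_ Vt wt1] := wt; have [sxw sxt] := segment_trans_right sw seg_t.
have [p [q [seg_p sq pq]]] := con w t x y wt Vx Vy sxw seg_t.
have [m1 r1] := seg_reach (piece_N Vw) (Proj_in Vw Vx) (Proj_in Vw Vy) seg_p.
have [m2 r2] := seg_reach (piece_N Vt) (Proj_in Vt Vx) (Proj_in Vt Vy) sq.
have [m3 r3] := IHk t Vt sxt ltac:(by move: wk; rewrite -natr1; lra).
have rpq : reach E (near_set E (guess x y)) 1 p q.
  exists (fun i => if i is 0%N then p else q); split=> //.
  - by case=> [|i] _; apply: near_set0; [lra|exists w|lra|exists t].
  - by case=> // _; lra.
exists (m1 + 1 + m2 + m3)%N; apply: reach_cat r3.
apply: (reach_cat (y := q)); last exact/reach_sym/(reachW E1 (inguess _ Vt sxt) r2).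
apply: (reach_cat (y := p)); last exact: rpq.
exact: reachW E1 (inguess _ Vw sw) r1.
Qed.

Lemma guess_coarse_paths (r : R) : 0 <= r ->
  exists2 D, 0 <= D & coarse_paths r D over_vertices guess.
Proof.
move=> r0; have [D1 D10 h1] := guess_connected; have [D2 D20 h2] := guess_small r0.
have [D3 D30 h3] := guess_slim; exists (D1 + D2 + D3); first lra.
split=> [x y Vx Vy|x y p Vx Vy xy gp|x y z Vx Vy Vz p gp].
- have [n [a [a0 an aN ast]]] := h1 x y Vx Vy; exists n, a; split=> // i iln.
    by apply: near_set_le (aN i iln); lra.
  by have := ast i iln; lra.
- by have := h2 x y p Vx Vy xy gp; lra.
- by apply: near_set_le (h3 x y z Vx Vy Vz p gp); lra.
Qed.

Variable phi : X -> X.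
Hypothesis phiP : forall x, V (pi (phi x)) /\ mdist x (phi x) <= 2.

(** Geodesics of X are sampled at unit times and moved to vertex spaces. *)
Lemma geodesic_quasi_path x y g : is_geodesic [set: X] mdist x y g ->
  exists n a, [/\ a 0%N = phi x, a n = phi y,
    quasi_path 5 5 over_vertices n a,
    forall i, near_set 2 (side mdist x y g) (a i)
  & forall p, side mdist x y g p -> exists2 i, (i <= n)%N & mdist p (a i) <= 3].
Proof.
move=> gg; have [g0 gl _ gd] := gg; have l0 := mdist_ge0 x y.
set l := mdist x y in gl gd l0 *.
have minb (i : nat) : 0 <= Num.min i%:R l <= l.
  by rewrite ge_min lexx orbT andbT le_min l0 ler0n.
have /andP[t1 t2] := truncn_bounds l0; set n := Num.truncn l in t1 t2.
pose a i := phi (g (Num.min i%:R l)).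
have ga (i j : nat) : `|mdist (a i) (a j) - `|Num.min i%:R l - Num.min j%:R l| | <= 4.
  rewrite -(gd _ _ (minb i) (minb j)); have [_ h1] := phiP (g (Num.min i%:R l)).
  have [_ h2] := phiP (g (Num.min j%:R l)); rewrite -/(a i) -/(a j) in h1 h2.
  set gi := g _ in h1 *; set gj := g (Num.min j%:R l) in h2 *.
  have := metric_triangle (a i) gi (a j); have := metric_triangle gi gj (a j).
  have := metric_triangle gi (a i) gj; have := metric_triangle (a i) (a j) gj.
  have := metric_sym (a i) gi; have := metric_sym (a j) gj.
  by rewrite ler_norml; lra.
exists n.+1, a; split.
- by rewrite /a min_l // g0.
- by rewrite /a min_r ?gl // -natr1 ltW.
- split=> [i _|i _|i j /andP[ij jn]]; first exact: (phiP _).1.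
    have := ga i i.+1; rewrite ler_norml => /andP[_].
    suff : `|Num.min i%:R l - Num.min i.+1%:R l| <= 1 by lra.
    by rewrite -natr1 ler_norml !minElt; do 2 case: ltP => ?; lra.
  have := ga i j; rewrite ler_norml => /andP[h _].
  suff : j%:R - i%:R - 1 <= `|Num.min i%:R l - Num.min j%:R l|.
    by have := mdist_ge0 (a i) (a j); lra.
  have jl : j%:R <= l + 1.
    have : j%:R <= n.+1%:R :> R by rewrite ler_nat.
    by rewrite -natr1; lra.
  have ij' : i%:R <= j%:R :> R by rewrite ler_nat.
  rewrite ler_normr; apply/orP; right.
  by rewrite !minElt; do 2 case: ltP => ?; lra.
- move=> i; exists (g (Num.min i%:R l)); last first.
    by rewrite metric_sym; exact: (phiP _).2.
  by exists (Num.min i%:R l) => //; exact: minb.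
- move=> p [s /= /andP[s0 sl] <-].
  have {}s0 : (0 : R) <= s := s0; have {}sl : (s : R) <= l := sl.
  have /andP[u1 u2] := truncn_bounds s0; exists (Num.truncn s).
    have : (Num.truncn s)%:R < n%:R + 1 :> R by lra.
    by rewrite natr1 ltr_nat => /ltnW.
  have [_ h] := phiP (g (Num.min (Num.truncn s)%:R l)).
  have : mdist (g s) (g (Num.min (Num.truncn s)%:R l)) <= 1.
    rewrite gd ?s0 //; first by rewrite ler_norml min_l; lra.
  have := metric_triangle (g s) (g (Num.min (Num.truncn s)%:R l)) (a (Num.truncn s)).
  by rewrite -/(a _) in h; lra.
Qed.

Theorem hyperbolic_total_space :
  exists2 delta' : R, 0 <= delta' & hyperbolic delta' [set: X] mdist.
Proof.
have [|D D0 cp] := @guess_coarse_paths 5; first by [].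
have [|||D' D'0 stab] := @coarse_paths_stability R X 5 D 5; rewrite ?ler0n //.
exists (3 + D' + D + D' + 2); first lra.
split=> // x y z f g h _ _ _ gf gg gh p seg_p.
have [n [a [a0 an qa _ pa]]] := geodesic_quasi_path gf.
have [_ s2] := stab _ _ cp n a qa; rewrite a0 an in s2.
have [i iln pai] := pa p seg_p; have h1 := near_set_dist pai (s2 i iln).
have [Vx Vy Vz] := And3 (phiP x).1 (phiP y).1 (phiP z).1.
have h2 := near_set_trans h1 (cp_slim cp Vx Vy Vz).
have follow x1 x2 k q : is_geodesic [set: X] mdist x1 x2 k ->
    guess (phi x1) (phi x2) q -> near_set (D' + 2) (side mdist x1 x2 k) q.
  move=> gk gq; have [m [b [b0 bm qb bn _]]] := geodesic_quasi_path gk.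
  have [s1 _] := stab _ _ cp m b qb; rewrite b0 bm in s1.
  by have [j _ qj] := s1 q gq; exact: near_set_dist qj (bn j).
suff : near_set (3 + D' + D + (D' + 2)) (side mdist y z g `|` side mdist z x h) p.
  by move=> [q sq pq]; exists q => //; lra.
apply: near_set_trans h2 _ => q [gq|gq].
  apply: near_setW (follow _ _ _ _ gh (guess_sym Vx Vz gq)) => // q' sq'; by right.
apply: near_setW (follow _ _ _ _ gg (guess_sym Vz Vy gq)) => // q' sq'; by left.
Qed.

End steps.
End projections.
Hypothesis edge_crossing : forall v w, adjacent V v w ->
  exists x y, [/\ pi x = v, pi y = w & mdist x y <= 2].
Hypothesis dense : forall x, exists2 y, V (pi y) & mdist x y <= 2.

Theorem tree_of_pieces_hyperbolic :
  exists2 delta' : R, 0 <= delta' & hyperbolic delta' [set: X] mdist.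
Proof.
have [Dg Dg0 gateP] := gate_exists.
have [x0 _] : exists x, V (pi x).
  have [v Vv] := st_nonempty treeV; have [x xv] := surj v.
  by exists x; rewrite xv.
(* one pair of neighbouring points for each unoriented edge *)
pose ends w t (c : X * X) := [/\ pi c.1 = w, pi c.2 = t & mdist c.1 c.2 <= 2].
pose pts w t := xget (x0, x0) [set c | ends w t c \/ ends t w c].
pose edge_end w t := if pi (pts w t).1 == w then (pts w t).1 else (pts w t).2.
have pts_sym w t : pts w t = pts t w.
  by rewrite /pts; congr xget; apply/seteqP; split=> c /= [h|h]; [right|left|right|left].
have ptsP w t : adjacent V w t -> ends w t (pts w t) \/ ends t w (pts w t).
  move=> wt; apply: (@xgetPex _ (x0, x0) [set c | ends w t c \/ ends t w c]).
  by have [x [y [xw yt xy]]] := edge_crossing wt; exists (x, y); left.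
have edge_end_pi w t : adjacent V w t -> pi (edge_end w t) = w.
  by rewrite /edge_end => /ptsP[[h1 h2 _]|[h1 h2 _]]; case: eqP.
have edge_end_dist w t : adjacent V w t -> mdist (edge_end w t) (edge_end t w) <= 2.
  move=> wt; have wnt := vertex_adjacent_neq wt.
  rewrite /edge_end (pts_sym t w); have [[-> h2 h]|[-> h2 h]] := ptsP w t wt; rewrite eqxx.
    by rewrite (negbTE (introN eqP wnt)).
  by rewrite (negbTE (introN eqP (nesym wnt))) metric_sym.
pose proj w t z := if `[< w = t >] then z else if `[< linked w t >] then
  xget x0 [set p | gate Dg (N w `|` N t) w z p] else edge_end w t.
have [step step_spec] : exists step : T -> T -> T, forall w u, V w -> V u ->
    [/\ V (step w u), segment w u (step w u), joined w (step w u), step w u = w -> w = u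
      & forall b, V b -> segment w u b -> joined w b -> segment w (step w u) b].
  pose Q (c : T * T) t := V c.1 -> V c.2 ->
    [/\ V t, segment c.1 c.2 t, joined c.1 t, t = c.1 -> c.1 = c.2
      & forall b, V b -> segment c.1 c.2 b -> joined c.1 b -> segment c.1 t b].
  suff /choice[f fP] : forall c, exists t, Q c t.
    by exists (fun w u => f (w, u)) => w u; exact: (fP (w, u)).
  move=> [w u]; have [Vw|nVw] := pselect (V w); last by exists w.
  have [Vu|nVu] := pselect (V u); last by exists w.
  by have [t h] := step_exists Vw Vu; exists t.
have [phi phiP] := choice (fun x => let: ex_intro2 y Vy xy := dense x in
    ex_intro (fun y => V (pi y) /\ mdist x y <= 2) y (conj Vy xy)).
apply: (hyperbolic_total_space (proj := proj) Dg0 _ _ _ edge_end_pi edge_end_dist step_spec phiP).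
- by move=> w z Vw; rewrite /proj asboolT.
- move=> w t z wt wnt zY; rewrite /proj asboolF // asboolT //.
  apply: (@xgetPex _ x0 [set p | gate Dg (N w `|` N t) w z p]).
  by have [Vw _ _] := wt; apply: gateP => //; exact: piece_linked.
- by move=> w t z wt nwt; have wnt := vertex_adjacent_neq wt; rewrite /proj !asboolF.
Qed.

End tree_of_pieces.

(** * Trees of metric spaces *)

Section path_metric.
Context {R : realType} {X : metricType R}.
Implicit Types (A : set X) (x y : X).

Lemma curve_length_ge (g : R -> X) : ((mdist (g 0) (g 1))%:E <= curve_length g)%E.
Proof.
apply: ereal_sup_ubound; exists [:: 1]; first by split => //=; rewrite ltr01.
by rewrite /= big_nat1.
Qed.

Lemma mdist_le_path_dist A x y : rectifiably_connected A -> A x -> A y ->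
  mdist x y <= path_dist A x y.
Proof.
move=> rA Ax Ay; rewrite /path_dist; set S := [set _ | _ in _].
have lbS : ((mdist x y)%:E <= ereal_inf S)%E.
  apply: le_ereal_inf_tmp => _ [g [_ <- <- _] <-]; exact: curve_length_ge.
have [g gA gl] := rA x y Ax Ay.
have ubS : (ereal_inf S < +oo)%E.
  by apply: le_lt_trans gl; apply: ereal_inf_lbound; exists g.
by move: lbS ubS; case: (ereal_inf S).
Qed.

Lemma piece_of_hyperbolic (delta : R) (eta : R -> R) A :
  rectifiably_connected A -> hyperbolic delta A (path_dist A) ->
  proper_embedding eta A (path_dist A) mdist id -> piece delta eta A.
Proof.
by move=> rA [gA sA] pA; split=> // x y; exact: mdist_le_path_dist.
Qed.

Lemma path_distxx A x : path_geodesic A -> A x -> path_dist A x x = 0.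
Proof.
move=> [rA gA] Ax; have [g [g0 _ _ gd]] := gA x x Ax Ax.
have l0 : 0 <= path_dist A x x.
  by apply: le_trans (mdist_le_path_dist rA Ax Ax); rewrite mdistxx.
have := gd 0 0; rewrite g0 !lexx l0 subrr normr0; exact.
Qed.

Lemma subset_nbhd (r : R) A : 0 <= r -> A `<=` nbhd r A.
Proof.
move=> r0 x Ax; rewrite /nbhd /=; apply: (@le_trans _ _ (mdist x x)%:E).
  by apply: ereal_inf_lbound; exists x.
by rewrite mdistxx lee_fin.
Qed.

Lemma nbhd_near (r : R) A x : nbhd r A x -> near_set (r + 1) A x.
Proof.
rewrite /nbhd /= => h; have : (ereal_inf [set (mdist x a)%:E | a in A] < (r + 1)%:E)%E.
  by apply: le_lt_trans h _; rewrite lte_fin; lra.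
move=> /ereal_inf_lt[_ [a Aa <-]]; rewrite lte_fin => /ltW xa; by exists a.
Qed.

End path_metric.

Section edge_cylinders.
Context {R : realType} {X T : metricType R}.
Variables (V : set T) (pi : X -> T).
Hypothesis ts : tree_of_spaces V pi.
Implicit Types (v w : T) (x y : X).

Let treeV := ts_tree ts.

Lemma over_edge_interior v w t : adjacent V v w -> segment v w t ->
  0 < mdist v t < 1 -> edge_interior v w t.
Proof.
move=> [_ _ vw1] step c01; split=> //= -[e|e]; move: c01; rewrite e ?mdistxx ?vw1; lra.
Qed.

Section one_edge.
Variables (phi : R -> R) (v w : T) (theta : X -> R -> X).
Hypotheses (vw : adjacent V v w) (th : edge_cylinder pi phi v w theta).
Hypothesis pg : path_geodesic (edge_space pi v w).

Lemma cylinder_interior_dist x (s s' : R) : edge_space pi v w x -> 0 < s < 1 ->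
  0 < s' < 1 -> mdist (theta x s) (theta x s') <= `|s - s'|.
Proof.
move=> Ex s01 s01'; have rA := ec_rectifiable th.
have inA (u : R) : 0 < u < 1 -> over pi (edge_interior v w) (theta x u).
  move=> u01; have u01' : 0 <= u <= 1 by lra.
  have [h1 h2] := ec_proj th Ex u01'; rewrite /over /=.
  by apply: over_edge_interior => //; rewrite h2.
apply: le_trans (mdist_le_path_dist rA (inA _ s01) (inA _ s01')) _.
rewrite (ec_isometry th) // /cylinder_dist path_distxx //.
by rewrite expr0n /= add0r sqrtr_sqr.
Qed.

Lemma cylinder_end x (e : R) : edge_space pi v w x -> e = 0 \/ e = 1 ->
  exists2 s, 0 < s < 1 & mdist (theta x e) (theta x s) <= 1 / 2.
Proof.
move=> Ex e01; have e01' : 0 <= e <= 1 by case: e01 => ->; lra.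
have [del del0 cont] := ec_continuous th Ex e01' (eps := 1 / 2) ltac:(lra).
pose d := Num.min (del / 2) (1 / 2).
have [d0 d1 d2] : [/\ 0 < d, d < del & d <= 1 / 2].
  by rewrite /d lt_min gt_min ge_min lexx orbT; split=> //; lra.
have [s s01 es] : exists2 s, 0 < s < 1 & `|e - s| = d.
  case: e01 => ->; [exists d|exists (1 - d)]; try lra.
    by rewrite sub0r normrN gtr0_norm.
  by rewrite opprB addrC subrK gtr0_norm.
exists s => //; apply/ltW/cont => //; first by lra.
by rewrite /cylinder_dist path_distxx // expr0n /= add0r sqrtr_sqr es.
Qed.

Lemma cylinder_start_vertex x : edge_space pi v w x -> pi (theta x 0) = v.
Proof.
move=> Ex; have [_ h] := ec_proj th Ex (s := 0) ltac:(lra).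
by apply/esym/mdist_positivity.
Qed.

Lemma cylinder_end_vertex x : edge_space pi v w x -> pi (theta x 1) = w.
Proof.
move=> Ex; have [h1 h2] := ec_proj th Ex (s := 1) ltac:(lra).
have [_ _ vw1] := vw; apply: mdist_positivity; move: h1; rewrite /segment /= h2 vw1.
lra.
Qed.

End one_edge.

Lemma edge_theta v w : adjacent V v w -> exists phi theta,
  edge_cylinder pi phi v w theta /\ path_geodesic (edge_space pi v w).
Proof.
move=> vw; have [phi _ [_ he]] := ts_fibers ts.
by have [pg [theta th]] := he v w vw; exists phi, theta.
Qed.

Lemma dist01 (s s' : R) : 0 < s < 1 -> 0 < s' < 1 -> `|s - s'| <= 1.
Proof. by move=> *; rewrite ler_norml; lra. Qed.

(** An edge space is joined to the vertex spaces at its ends by the cylinder, whose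
    fibres have length 1; continuity is needed to reach the ends, since the cylinder
    is an isometry only over the open edge. *)
Lemma vertex_spaces_dense x : exists2 y, V (pi y) & mdist x y <= 2.
Proof.
have [Vx|nVx] := pselect (V (pi x)); first by exists x => //; rewrite mdistxx.
have [//|[v [w [vw sx]]]] := st_cover treeV (pi x).
have [phi [theta [th pg]]] := edge_theta vw.
have [x0 [s [Ex s01 <-]]] := ec_onto th (y := x) (edge_interiorP vw sx nVx).
have [s' s01' h] := cylinder_end th pg Ex (or_introl erefl).
exists (theta x0 0); first by rewrite (cylinder_start_vertex th Ex); case: vw.
have := cylinder_interior_dist vw th pg Ex s01 s01'; have := dist01 s01 s01'.
have := metric_triangle (theta x0 s) (theta x0 s') (theta x0 0).
by have := metric_sym (theta x0 s') (theta x0 0); lra.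
Qed.

Lemma edge_crossing_points v w : adjacent V v w ->
  exists x y, [/\ pi x = v, pi y = w & mdist x y <= 2].
Proof.
move=> vw; have [phi [theta [th pg]]] := edge_theta vw.
have [t step dt] := edge_at treeV vw (s := 1 / 2) ltac:(lra).
have [x xt] := ts_surjective ts t.
have Ex : edge_space pi v w x by rewrite /edge_space /over /= xt.
have [s s01 h] := cylinder_end th pg Ex (or_introl erefl).
have [s' s01' h'] := cylinder_end th pg Ex (or_intror erefl).
exists (theta x 0), (theta x 1); split.
- exact: (cylinder_start_vertex th Ex).
- exact: (cylinder_end_vertex vw th Ex).
have := cylinder_interior_dist vw th pg Ex s01 s01'; have := dist01 s01 s01'.
have := metric_triangle (theta x 0) (theta x s) (theta x 1).
have := metric_triangle (theta x s) (theta x s') (theta x 1).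
by have := metric_sym (theta x s') (theta x 1); lra.
Qed.

End edge_cylinders.

Theorem theorem1p6 (R : realType) (X T : metricType R) (V : set T)
    (pi : X -> T) (M : T -> set X) (L' C L delta : R) (eta : R -> R) :
  tree_of_spaces V pi ->
  (forall u, V u -> vertex_space pi u `<=` M u) ->
  0 <= L' -> 0 <= C -> 0 <= L -> 0 <= delta -> proper_map eta ->
  prop_P0 V pi M ->
  prop_P1 V pi M L' C ->
  prop_P2 V M L eta ->
  prop_P3 V pi M L eta ->
  prop_P4 V pi M L delta ->
  geodesic_space [set: X] mdist /\
  exists2 delta' : R, 0 <= delta' & hyperbolic delta' [set: X] mdist.
Proof.
move=> ts XM L'0 C0 L0 delta0 [eta0 _] P0 P1 _ P3 P4.
have treeV := ts_tree ts; have gX := ts_geodesic ts; split=> //.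
have /choice[rho rhoP] : forall u, exists r : X -> X, V u ->
    coarse_retraction L' (M u) r /\
    forall t v S, adjacent V t v -> (pi @` M u) t -> ~ (pi @` M u) v ->
      max_subtree_avoiding V v t S -> diam_le (r @` over pi S) C.
  move=> u; have [Vu|nVu] := pselect (V u); last by exists id.
  by have [r r1 r2] := P1 u Vu; exists r.
have XM' x : V (pi x) -> M (pi x) x by move=> Vx; apply: XM.
have piece_linked u v : linked V pi M u v -> piece delta eta (nbhd L (M u) `|` nbhd L (M v)).
  move=> [Vu Vv h]; have si : special_interval V pi M u v.
    split=> //; case: h => h.
      by left; have [m Mm mv] := h v Vv (segment_r u v); exists m.
    by right; have [m Mm mu] := h u Vu (segment_r v u); exists m.
  by have [rA hA] := P4 u v si; have [_ pA] := P3 u v si; exact: piece_of_hyperbolic.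
have piece_N u : V u -> piece delta eta (nbhd L (M u)).
  move=> Vu; rewrite -[X in piece _ _ X]setUid; apply: piece_linked.
  exact: (linked_refl (ts_surjective ts) XM' (fun v _ => @subset_nbhd _ _ L (M v) L0)).
apply: (@tree_of_pieces_hyperbolic R X T V pi M (fun u => nbhd L (M u)) rho L' C (L + 1)
  delta eta) => //.
- lra.
- exact: ts_lipschitz ts.
- exact: ts_surjective ts.
- by move=> u _; exact: subset_nbhd.
- by move=> u x _; exact: nbhd_near.
- move=> u b m Vu Vb Mm sb; have [<- //|/eqP ub] := eqVneq u b.
  have [w [bw sw _]] := vertex_next treeV Vb Vu (nesym ub).
  have swb : segment w b `<=` segment u b.
    by move=> t step; have [] := segment_trans_right (segment_sym sw) step.
  have [_ smw] := segment_trans sb (segment_sym sw).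
  by have [] := P0 u b w _ Vu Vb ub (adjacent_sym bw) swb (halftree_maximal treeV bw) m
    (conj Mm smw).
- by move=> u /rhoP[].
- move=> u t v Vu tv Mt nMv x y sx sy; have [_ h] := rhoP u Vu.
  apply: (h t v _ tv Mt nMv (halftree_maximal treeV (adjacent_sym tv))).
    by exists x.
  by exists y.
- exact: edge_crossing_points ts.
- exact: vertex_spaces_dense ts.
Qed.
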